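(* Let $C:\Omega_5\to\mathbb R$ be a $G$-invariant alternating function, continuous on $\Omega_5$, with $dC=0$ pointwise on $\Omega_6$. Suppose $$C=F+df\quad\text{almost everywhere},$$ where $F\in L^\infty(X^5)^G$ and $f\in L^0(X^4)^G$. Then every finite generic real orbit four-cycle $Z$ satisfies $$|\langle C,Z\rangle|\le 20\,\|Z\|_1\,\|F\|_\infty .$$
   Context: $V=\mathbb C^4$ carries a nondegenerate alternating $\mathbb C$-bilinear form $\omega$, $G=\mathrm{Sp}(V,\omega)$, and $X=\mathbb P(V)$ with its smooth measure class (product class on $X^n$). $L^0(X^n)^G$, resp. $L^\infty(X^n)^G$, are the diagonally $G$-invariant classes (modulo a.e. equality) of real a.e. finite measurable, resp. essentially bounded, functions. The coboundary is $(dc)(x_0,\dots,x_{q+1})=\sum_{i}(-1)^ic(x_0,\dots,\widehat{x_i},\dots,x_{q+1})$. Generic tuples: for $n\ge 4$, $\Omega_n\subset X^n$ is the set of ordered tuples $(\ell_0,\dots,\ell_{n-1})$ with $\omega(v_i,v_j)\neq0$ for all $i\ne j$ ($0\neq v_i\in\ell_i$) and such that every four of the lines span $V$; it is open and conull. A function on $\Omega_n$ is alternating if permuting its arguments by $\sigma\in S_n$ multiplies it by $\operatorname{sgn}(\sigma)$. Orbit chains: for $k\ge3$, $\widetilde{\mathscr C}_k$ is the real vector space generated by symbols $[\mathbf x]$, $\mathbf x\in\Omega_{k+1}$, modulo $[\sigma\mathbf x]=\operatorname{sgn}(\sigma)[\mathbf x]$, and $\mathscr C_k^{\mathrm{orb}}$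 is its quotient by the span of all $gc-c$ ($g\in G$, $c\in\widetilde{\mathscr C}_k$). The boundary is $\partial[x_0,\dots,x_k]=\sum_i(-1)^i[x_0,\dots,\widehat{x_i},\dots,x_k]$. A finite (generic, real) orbit four-cycle is $Z\in\mathscr C_4^{\mathrm{orb}}$ with $\partial Z=0$ in $\mathscr C_3^{\mathrm{orb}}$. Its mass is $\|Z\|_1=\inf\{\sum_j|c_j|: Z=\sum_jc_j[\mathbf x_j]\}$ (finite sums), and $\langle C,\sum_jc_j[\mathbf x_j]\rangle=\sum_jc_jC(\mathbf x_j)$, which is well defined for invariant alternating $C$. *)

(* Defs.v *)
From HB Require Import structures.
From mathcomp Require Import all_boot all_order all_fingroup all_algebra sesquilinear.
From mathcomp Require Import all_classical all_reals all_analysis.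
From mathcomp Require Import complex.

Set Implicit Arguments.
Unset Strict Implicit.
Unset Printing Implicit Defensive.

Import Order.TTheory GRing.Theory Num.Theory.
Import numFieldNormedType.Exports.

Local Open Scope classical_set_scope.
Local Open Scope ring_scope.

Section Tuples.
Variables (T : Type) (n : nat).

Definition face (i : 'I_n.+1) (x : n.+1.-tuple T) : n.-tuple T :=
  [tuple tnth x (lift i j) | j < n].

Definition permt (s : 'S_n) (x : n.-tuple T) : n.-tuple T :=
  [tuple tnth x (s j) | j < n].

Definition coboundary (R : pzRingType) (c : n.-tuple T -> R)
    (x : n.+1.-tuple T) : R :=
  \sum_(i < n.+1) (-1) ^+ i * c (face i x).

End Tuples.

(* The product topology on [n.-tuple T], which the library does not provide. *)
HB.instance Definition _ (n : nat) (T : topologicalType) :=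
  Topological.copy (n.-tuple T)
    (initial_topology
       (fun x : n.-tuple T => (tnth x : prod_topology (fun _ : 'I_n => T)))).

Section ProductMeasure.
Context d (T : measurableType d) (R : realType).

Section Step.
Variable n : nat.
Variables (mu : {sigma_finite_measure set T -> \bar R})
  (nu : {sigma_finite_measure set (n.-tuple T) -> \bar R}).

Definition cons2 (p : T * n.-tuple T) : n.+1.-tuple T :=
  [the n.+1.-tuple T of p.1 :: p.2].

Fact mcons2 : measurable_fun [set: T * n.-tuple T] cons2.
Proof. exact: (measurable_cons measurable_fst measurable_snd). Qed.

Definition cons_measure : set (n.+1.-tuple T) -> \bar R :=
  pushforward (mu \x nu)%E cons2.

Fact cons_measure0 : cons_measure set0 = 0%E.
Proof. by rewrite /cons_measure /pushforward preimage_set0 measure0. Qed.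

Fact cons_measure_ge0 A : (0 <= cons_measure A)%E.
Proof. exact: (measure_ge0 (mu \x nu)%E). Qed.

Fact cons_measure_additive : semi_sigma_additive cons_measure.
Proof.
exact: (measure_semi_sigma_additive
  (s := pushforward (mu \x nu)%E (mfun_Sub (mem_set mcons2)))).
Qed.

HB.instance Definition _ := isMeasure.Build _ _ _ cons_measure
  cons_measure0 cons_measure_ge0 cons_measure_additive.

Fact cons_measure_sigma_finite : sigma_finite setT cons_measure.
Proof.
have /sigma_finiteP[F [TF ndF Foo]] := sigma_finiteT mu.
have /sigma_finiteP[G [TG ndG Goo]] := sigma_finiteT nu.
exists (fun k => [set x : n.+1.-tuple T |
                  F k (thead x) /\ G k [tuple of behead x]]).
  apply/esym; rewrite predeqE => x; split=> // _.
  have : setT (thead x) by []; rewrite TF => -[i _ Fi].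
  have : setT [tuple of behead x] by []; rewrite TG => -[j _ Gj].
  exists (maxn i j) => //; split.
    by move: Fi; exact/subsetPset/ndF/leq_maxl.
  by move: Gj; exact/subsetPset/ndG/leq_maxr.
move=> k; have [mF Fk] := Foo k; have [mG Gk] := Goo k; split.
  apply: measurableI.
    by rewrite -[X in measurable X]setTI; exact: measurable_tnth.
  by rewrite -[X in measurable X]setTI; exact: measurable_behead.
rewrite /cons_measure /pushforward (_ : _ @^-1` _ = F k `*` G k).
  by rewrite product_measure1E// lte_mul_pinfty// ge0_fin_numE.
have tnt (p : T * n.-tuple T) : [tuple of behead (cons2 p)] = p.2 by exact: val_inj.
by apply/seteqP; split => p /=; rewrite tnt.
Qed.

HB.instance Definition _ := Measure_isSigmaFinite.Build _ _ _ cons_measure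
  cons_measure_sigma_finite.

End Step.

Fixpoint tuple_measure (mu : {sigma_finite_measure set T -> \bar R}) (n : nat) :
    {sigma_finite_measure set (n.-tuple T) -> \bar R} :=
  match n with
  | 0%N => [the {sigma_finite_measure set (0.-tuple T) -> \bar R}
            of \d_([tuple] : 0.-tuple T)]
  | m.+1 => [the {sigma_finite_measure set (m.+1.-tuple T) -> \bar R}
             of cons_measure mu (tuple_measure mu m)]
  end.

End ProductMeasure.

(* R[i] has no topology in the library; it is given that of the modulus. *)
HB.instance Definition _ (R : rcfType) :=
  PseudoPointedMetric.copy R[i] (R[i])^o.

Notation C4 R := 'cV[R[i]]_4.

Section Projective.
Variable R : realType.

Record projective := Projective {
  line : {vspace C4 R};
  line_dim : \dim line == 1%N }.

HB.instance Definition _ := [isSub for line].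
HB.instance Definition _ := [Choice of projective by <:].

Fact line0_dim : \dim <[(delta_mx 0 0)%R : C4 R]>%VS == 1%N.
Proof.
suff e0 : (delta_mx 0 0 : C4 R) != 0 by rewrite dim_vline e0.
by apply/eqP => /matrixP/(_ 0 0)/eqP; rewrite !mxE eqxx oner_eq0.
Qed.

HB.instance Definition _ := isPointed.Build projective (Projective line0_dim).

(* The projection of V \ {0} onto P(V); its value at 0 is a dummy. *)
Definition proj (v : C4 R) : projective := insubd (point : projective) <[v]>%VS.

Lemma projE (v : C4 R) : v != 0 -> line (proj v) = <[v]>%VS.
Proof. by move=> v0; apply: insubdK; rewrite unfold_in dim_vline v0. Qed.

(* The quotient topology of V \ {0}, which is itself open in V. *)
Definition projective_open : set (set projective) :=
  [set U | open [set v : C4 R | v != 0 /\ U (proj v)]].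

Fact projective_openT : projective_open setT.
Proof.
rewrite /projective_open /= (_ : [set _ | _] = ~` [set 0]); last first.
  by apply/seteqP; split => v /=; [case=> /eqP|move=> /eqP].
apply: closed_openC; apply: accessible_closed_set1.
apply: hausdorff_accessible.
exact: (@norm_hausdorff R[i] 'cV[(R[i] : numFieldType)]_4).
Qed.

Fact projective_openI : setI_closed projective_open.
Proof.
move=> A B oA oB; rewrite /projective_open /=.
rewrite (_ : [set _ | _] = [set v : C4 R | v != 0 /\ A (proj v)] `&`
                           [set v : C4 R | v != 0 /\ B (proj v)]).
  exact: openI.
by apply/seteqP; split => v /=; [move=> [? []]|move=> [[? ?] []]].
Qed.

Fact projective_open_bigU (I : Type) (f : I -> set projective) :
  (forall i, projective_open (f i)) -> projective_open (\bigcup_i f i).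
Proof.
move=> of_; rewrite /projective_open /=.
rewrite (_ : [set _ | _] =
             \bigcup_i [set v : C4 R | v != 0 /\ f i (proj v)]).
  by apply: bigcup_open => i _; exact: of_.
apply/seteqP; split => v /=; first by move=> [v0 [i _ fi]]; exists i.
by move=> [i _ [v0 fi]]; split => //; exists i.
Qed.

HB.instance Definition _ := isOpenTopological.Build projective
  projective_openT projective_openI projective_open_bigU.

Definition projective_display : measure_display.
Proof. by constructor. Qed.

HB.instance Definition _ := @isMeasurable.Build projective_display projective
  <<s [set U : set projective | open U] >>
  (@sigma_algebra0 _ setT _) (@sigma_algebraC _ _)
  (@sigma_algebra_bigcup _ setT _).

(* The affine chart [z_0 : .. : 1 : .. : z_2] with 1 in position i, where z_j
   has real part t_j and imaginary part t_(3 + j). *)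
Definition chart (i : 'I_4) (t : (3 + 3).-tuple (measurableTypeR R)) :
    projective :=
  proj (\col_k if unlift i k is Some j
               then Complex (tnth t (lshift 3 j)) (tnth t (rshift 3 j)) else 1).

(* mu belongs to the smooth measure class of the manifold P(V): its null sets
   are those that are Lebesgue-null in every chart.  The product class on X^n is
   then that of [tuple_measure mu n], whichever sigma-finite mu is taken. *)
Definition smooth_measure_class (mu : set projective -> \bar R) :=
  forall A : set projective, measurable A ->
    (mu A = 0%E <->
     forall i,
       tuple_measure (@lebesgue_measure R) (3 + 3) (chart i @^-1` A) = 0%E).

End Projective.

Section Symplectic.
Variables (R : realType) (omega : {biscalar C4 R}).
Notation X := (projective R).

Definition alternating_form := forall v : C4 R, omega v v = 0.

Definition nondegenerate_form :=
  forall u : C4 R, (forall v : C4 R, omega u v = 0) -> u = 0.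

Definition Sp : set 'M[R[i]]_4 :=
  [set g | g \in unitmx /\
           forall u v : C4 R, omega (g *m u) (g *m v) = omega u v].

(* The line g(x); equal to x, as a dummy, if g kills x. *)
Definition act (g : 'M[R[i]]_4) (x : X) : X :=
  insubd x (linfun (mulmx g : C4 R -> C4 R) @: line x)%VS.

Definition actt n (g : 'M[R[i]]_4) (x : n.-tuple X) : n.-tuple X :=
  [tuple of map (act g) x].

Definition Omega n : set (n.-tuple X) :=
  [set x | (forall (i j : 'I_n) (v w : C4 R), i != j ->
              v \in line (tnth x i) -> v != 0 ->
              w \in line (tnth x j) -> w != 0 -> omega v w != 0) /\
           (forall S : {set 'I_n}, #|S| = 4%N ->
              (\sum_(i in S) line (tnth x i))%VS = fullv)].

Definition invariant_on n (D : set (n.-tuple X)) (c : n.-tuple X -> R) :=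
  forall g x, Sp g -> D x -> c (actt g x) = c x.

Definition alternating_on n (D : set (n.-tuple X)) (c : n.-tuple X -> R) :=
  forall s x, D x -> c (permt s x) = (-1) ^+ s * c x.

Section Classes.
Variables (mu : {sigma_finite_measure set X -> \bar R}) (n : nat).

(* c represents an element of L^0(X^n)^G: invariance is that of the class, so
   the exceptional null set may depend on g.  Every class of a.e. finite
   measurable functions has a real-valued Borel representative. *)
Definition L0_inv (c : n.-tuple X -> R) :=
  measurable_fun [set: n.-tuple X] c /\
  forall g, Sp g ->
    \forall x \ae tuple_measure mu n, c (actt g x) = c x.

Definition Linfty_inv (c : n.-tuple X -> R) :=
  L0_inv c /\ finite_norm (tuple_measure mu n) +oo%E c.

End Classes.

(* The list [:: (c_1, x_1); ..; (c_m, x_m)] stands for the formal sum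
   c_1 [x_1] + .. + c_m [x_m]. *)
Definition fsum n := seq (R * n.-tuple X).

Definition coef n (Z : fsum n) (x : n.-tuple X) : R :=
  \sum_(p <- Z | p.2 == x) p.1.

Definition generic n (Z : fsum n) := forall p, p \in Z -> Omega p.2.

(* The relations [s x] = sgn(s) [x] and [g x] = [x]; the latter span all the
   g c - c. *)
Definition orbit_relation n : set (fsum n) :=
  [set r | (exists s x, Omega x /\
              r = [:: (1, permt s x); (- (-1) ^+ (s : 'S_n), x)]) \/
           (exists g x, [/\ Sp g, Omega x &
              r = [:: (1, actt g x); (-1, x)]])].

(* Z and Z' are equal in the orbit chains: their difference in the free vector
   space is a linear combination of relations. *)
Definition orbit_eq n (Z Z' : fsum n) :=
  exists2 rs : seq (R * fsum n),
    (forall r, r \in rs -> orbit_relation r.2) &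
    (forall x, coef Z x - coef Z' x = \sum_(r <- rs) r.1 * coef r.2 x).

Definition boundary n (Z : fsum n.+1) : fsum n :=
  [seq ((-1) ^+ i * p.1, face i p.2)
     | p : R * n.+1.-tuple X <- Z, i : 'I_n.+1 <- enum 'I_n.+1].

Definition orbit_cycle n (Z : fsum n.+1) :=
  generic Z /\ orbit_eq (boundary Z) [::].

Definition mass n (Z : fsum n) : R :=
  inf [set m | exists Z' : fsum n,
         [/\ generic Z', orbit_eq Z Z' & m = \sum_(p <- Z') `|p.1|]].

Definition pairing n (c : n.-tuple X -> R) (Z : fsum n) : R :=
  \sum_(p <- Z) p.1 * c p.2.

End Symplectic.

Arguments Omega {R} omega {n}.

(* Main.v *)
Require Import Defs.
From HB Require Import structures.
From mathcomp Require Import all_boot all_order all_fingroup all_algebra sesquilinear.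
From mathcomp Require Import all_classical all_reals all_analysis.
From mathcomp Require Import measurable_realfun ess_sup_inf complex ring lra.

Set Implicit Arguments.
Unset Strict Implicit.
Unset Printing Implicit Defensive.

Import Order.TTheory GRing.Theory Num.Theory.
Import numFieldNormedType.Exports.

Local Open Scope classical_set_scope.
Local Open Scope ring_scope.

Local Notation proj := Defs.proj.
Local Notation act := Defs.act.

(** The class [f] is first replaced by a version that is exactly invariant.
    A quadruple [p] of vectors in general position determines a symplectic frame,
    hence an element [K_p] of [G] up to scaling, with [K_(g p) g = K_p]; the new
    value at [x] is the one that [f (K_p x)] takes for almost every [p].  As [G]
    is transitive on triples in general position, the estimate [|C - df| <= B]
    then holds at [(t, a, b)] for each such triple [t] and almost all [a], [b].
    Put [h_y t = C (t, y) - (d (f (., y))) t].  By the cocycle identity [C = d h_y],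
    and [h_a - h_b] is at [t] the coboundary of [(C - df) (., a, b)], hence at
    most [4 B].  So [phi t = ess inf_y h_y t] is invariant with
    [|C - d phi| <= 20 B] everywhere, and once alternated [d phi] is invisible to
    cycles.  Null sets are handled on [V = R^8], where [G] acts linearly, rather
    than on [P(V)]. *)

(** * Null sets of product measures *)

(** A cycle is carried by finitely many [G]-orbits of [X^5]. As [dim G = 10] and [dim X^5 = 15],
    these form a null set, on which classes such as [F] and [f] have no values; so a bound almost
    everywhere must be turned into a bound at every generic tuple. Homogeneity can do this for three
    points at most: [G] is not transitive on generic quadruples, since [dim X^4 = 12]. With
    [E = C - df] one has [h_y t = f t + E (t, y)], where [t] consists of four fixed points, so
    [E (t, y)] itself is out of reach. But [dE = 0] rewrites [E (t, a) - E (t, b)] as an alternating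
    sum of values of [E] at three points of [t] followed by [a] and [b], and those are under
    control. This is why two auxiliary points occur, and why [20 = 5 * 4]: four faces of [t], five
    faces in [d phi]. The frame is polynomial in [p], without division, so that [K_p] depends
    measurably on [p]. The square root that turns a similitude into an element of [G] acts trivially
    on [P(V)] and is never chosen measurably. *)

Section ProductNull.
Context d1 d2 (T1 : measurableType d1) (T2 : measurableType d2) (R : realType).
Variables (m1 : {sigma_finite_measure set T1 -> \bar R})
  (m2 : {sigma_finite_measure set T2 -> \bar R}).

Lemma product_measure1_eq0 (E : set (T1 * T2)) : measurable E ->
  (m1 \x m2)%E E = 0%E <-> \forall x \ae m1, m2 (xsection E x) = 0%E.
Proof.
move=> mE.
have mphi := measurable_fun_xsection m2 mE.
have e : (m1 \x m2)%E E = (\int[m1]_x `|(m2 \o xsection E) x|)%E.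
  by apply: eq_integral => x _; rewrite gee0_abs ?measure_ge0.
have := ae_eq_integral_abs m1 measurableT mphi; rewrite -e => H.
split=> [/H|h]; first by apply: filterS => x; apply.
by apply/H; apply: filterS h => x + _.
Qed.

(** Fubini for null sets: the two iterated integrals are measures that agree on rectangles, so by
    uniqueness the complement of [E] is null for either order of integration. *)
Lemma ae_swap (E : set (T1 * T2)) : measurable E ->
  (\forall x \ae m1, \forall y \ae m2, E (x, y)) ->
  \forall y \ae m2, \forall x \ae m1, E (x, y).
Proof.
move=> mE h; have mE' : measurable (~` E) by exact: measurableC.
have E0 : (m1 \x m2)%E (~` E) = 0%E.
  apply/product_measure1_eq0 => //; apply: filterS h => x hx.
  apply/negligibleP; first exact: measurable_xsection.
  by apply: negligibleS hx => y /=; rewrite /xsection/= inE.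
have : (m1 \x^ m2)%E (~` E) = 0%E.
  rewrite -E0; apply/esym/product_measure_unique => // A B mA mB.
  exact: product_measure2E.
have mphi := measurable_fun_ysection m1 mE'.
have -> : (m1 \x^ m2)%E (~` E) = (\int[m2]_y `|(m1 \o ysection (~` E)) y|)%E.
  by apply: eq_integral => y _; rewrite gee0_abs ?measure_ge0.
move=> /(ae_eq_integral_abs m2 measurableT mphi).
apply: filterS => y /(_ I) /= hy.
exists (ysection (~` E) y); split => //; first exact: measurable_ysection.
by move=> x /= nE; rewrite /ysection/= inE.
Qed.

End ProductNull.

Lemma measurable_face d (T : measurableType d) n (i : 'I_n.+1) :
  measurable_fun setT (@face T n i).
Proof.
apply/measurable_fun_tnthP => j.
rewrite (_ : _ \o _ = fun x => tnth x (lift i j)); first exact: measurable_tnth.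
by apply/funext => x /=; rewrite tnth_mktuple.
Qed.

Lemma measurable_map_tuple d1 d2 (T1 : measurableType d1)
    (T2 : measurableType d2) n (h : T1 -> T2) : measurable_fun setT h ->
  measurable_fun setT (fun x : n.-tuple T1 => [tuple of map h x]).
Proof.
move=> mh; apply/measurable_fun_tnthP => j.
rewrite (_ : _ \o _ = fun x => h (tnth x j)).
  by apply: measurableT_comp => //; exact: measurable_tnth.
by apply/funext => x /=; rewrite tnth_map.
Qed.

Section TupleNull.
Context d (T : measurableType d) (R : realType).
Implicit Types mu : {sigma_finite_measure set T -> \bar R}.

Lemma tuple_measureS_eq0 mu n (N : set (n.+1.-tuple T)) : measurable N ->
  tuple_measure mu n.+1 N = 0%E <->
  \forall a \ae mu, tuple_measure mu n [set t : n.-tuple T | N (cons_tuple a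
    t)] = 0%E.
Proof.
move=> mN; have mN2 : measurable (@cons2 d T n @^-1` N).
  by rewrite -[X in measurable X]setTI; exact: mcons2.
have := product_measure1_eq0 mu (tuple_measure mu n) mN2.
have e a : xsection (@cons2 d T n @^-1` N) a = [set t : n.-tuple T | N
  (cons_tuple a t)].
  by apply/seteqP; split => t; rewrite /xsection/= inE.
by under eq_near do rewrite e.
Qed.

Lemma ae_tuple_cons mu n (P : set (n.+1.-tuple T)) :
  (\forall x \ae tuple_measure mu n.+1, P x) ->
  \forall a \ae mu, \forall t \ae tuple_measure mu n, P (cons_tuple a t).
Proof.
move=> [N [mN /tuple_measureS_eq0 - /(_ mN) N0 PN]].
apply: filterS N0 => a Na; exists [set t : n.-tuple T | N (cons_tuple a t)];
  split => //.
  rewrite -[X in measurable X]setTI.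
  exact: (measurable_cons (measurable_cst a) (@measurable_id _ _ setT)).
by move=> t nP; exact: PN.
Qed.

Lemma tuple_measure_null mu n (N : set (n.+1.-tuple T)) : measurable N ->
  (\forall a \ae mu, \forall t \ae tuple_measure mu n, ~ N (cons_tuple a t)) ->
  tuple_measure mu n.+1 N = 0%E.
Proof.
move=> mN h; apply/tuple_measureS_eq0 => //; apply: filterS h => a ha.
apply/negligibleP.
  rewrite -[X in measurable X]setTI.
  exact: (measurable_cons (measurable_cst a) (@measurable_id _ _ setT)).
by apply: negligibleS ha => t /= Nt /(_ Nt).
Qed.

Lemma tuple_measure_setT_gt0 mu n : (0 < mu setT)%E ->
  (0 < tuple_measure mu n setT)%E.
Proof.
move=> mu0; elim: n => [|n IH]; first by rewrite /= diracT lte_fin.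
rewrite lt0e measure_ge0 andbT; apply/eqP => /tuple_measureS_eq0.
move=> /(_ measurableT) h.
have [a /=] : exists a, tuple_measure mu n
    [set t : n.-tuple T | [set: n.+1.-tuple T] (cons_tuple a t)] = 0%E.
  by apply: filter_ex h; exact: ae_properfilter_algebraOfSetsType.
rewrite (_ : [set _ | _] = setT); last by apply/seteqP; split.
by move=> e; rewrite e ltxx in IH.
Qed.

End TupleNull.

(** Nonsingular in the sense of ergodic theory: enough to pull almost-everywhere statements back
    along [h], and free of Jacobians. *)
Definition nonsingular d1 d2 (T1 : measurableType d1) (T2 : measurableType d2)
    (R : realType) (m1 : set T1 -> \bar R) (m2 : set T2 -> \bar R)
    (h : T1 -> T2) :=
  measurable_fun setT h /\
  forall N, measurable N -> m2 N = 0%E -> m1 (h @^-1` N) = 0%E.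

Lemma nonsingular_ae d1 d2 (T1 : measurableType d1) (T2 : measurableType d2)
    (R : realType) (m1 : {measure set T1 -> \bar R})
    (m2 : {measure set T2 -> \bar R}) (h : T1 -> T2) (P : set T2) :
  nonsingular m1 m2 h -> (\forall y \ae m2, P y) -> \forall x \ae m1, P (h x).
Proof.
move=> [mh h0] [N [mN N0 PN]]; exists (h @^-1` N); split.
- by rewrite -[X in measurable X]setTI; exact: mh.
- exact: h0.
- by move=> x nP; exact: PN.
Qed.

Lemma nonsingular_map_tuple d1 d2 (T1 : measurableType d1)
    (T2 : measurableType d2) (R : realType)
    (m1 : {sigma_finite_measure set T1 -> \bar R})
    (m2 : {sigma_finite_measure set T2 -> \bar R}) (h : T1 -> T2) n :
  nonsingular m1 m2 h ->
  nonsingular (tuple_measure m1 n) (tuple_measure m2 n)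
    (fun x => [tuple of map h x]).
Proof.
move=> hns; have mh := hns.1; split; first exact: measurable_map_tuple.
elim: n => [|n IH] N mN N0.
  (* The measure on 0-tuples is a point mass at the empty tuple, so its null sets are empty. *)
  have -> : (fun x : 0.-tuple T1 => [tuple of map h x]) @^-1` N = set0.
    apply/seteqP; split => // x /=; rewrite [X in N X]tuple0.
    move: N0; rewrite /= diracE; have [_|] := boolP ([tuple] \in N).
      by move=> [] /eqP; rewrite oner_eq0.
    by rewrite notin_setE.
  exact: measure0.
apply: tuple_measure_null.
  by rewrite -[X in measurable X]setTI; exact: measurable_map_tuple.
have /ae_tuple_cons : \forall x \ae tuple_measure m2 n.+1, ~ N x.
  by exists N; split => // x /= /contrapT.
move=> /(nonsingular_ae hns); apply: filterS => a h2.
have : nonsingular (tuple_measure m1 n) (tuple_measure m2 n)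
    (fun x => [tuple of map h x]).
  by split => //; exact: measurable_map_tuple.
move=> /nonsingular_ae/(_ h2); apply: filterS => t /=.
by rewrite (_ : cons_tuple (h a) _ = [tuple of map h (cons_tuple a t)])//;
  exact: val_inj.
Qed.

Lemma face_ord0 (T : Type) n a (t : n.-tuple T) :
  face ord0 (cons_tuple a t) = t.
Proof. by apply: eq_from_tnth => j; rewrite tnth_mktuple tnthS. Qed.

Lemma face_lift0 (T : Type) n (i : 'I_n.+1) a (t : n.+1.-tuple T) :
  face (lift ord0 i) (cons_tuple a t) = cons_tuple a (face i t).
Proof.
apply: eq_from_tnth => j; rewrite tnth_mktuple.
have [k ->|->] := unliftP ord0 j.
  rewrite (_ : lift (lift ord0 i) (lift ord0 k) = lift ord0 (lift i k)).
    by rewrite !tnthS tnth_mktuple.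
  by apply: val_inj; rewrite /= /bump !add1n ltnS addnS.
by rewrite (_ : lift _ _ = ord0) //; exact: val_inj.
Qed.

(** The preimage of a null set is a cylinder over it. Its slices by the first coordinate are that
    null set itself when [i = 0], and otherwise preimages under a face of the tail. *)
Lemma nonsingular_face d (T : measurableType d) (R : realType)
    (mu : {sigma_finite_measure set T -> \bar R}) n (i : 'I_n.+1) :
  nonsingular (tuple_measure mu n.+1) (tuple_measure mu n) (@face T n i).
Proof.
split; first exact: measurable_face.
elim: n i => [|n IH] i N mN N0; apply: tuple_measure_null.
- by rewrite -[X in measurable X]setTI; exact: measurable_face.
- apply: nearW => a; exists N; split => // t /contrapT.
  by rewrite ord1 /= face_ord0.
- by rewrite -[X in measurable X]setTI; exact: measurable_face.
- have aeN : \forall x \ae tuple_measure mu n.+1, ~ N x.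
    by exists N; split => // x /= /contrapT.
  have [k ->|->] := unliftP ord0 i.
    move: aeN => /ae_tuple_cons; apply: filterS => a h2.
    have : nonsingular (tuple_measure mu n.+1) (tuple_measure mu n) (@face T n
      k).
      by split => //; [exact: measurable_face|exact: IH].
    by move=> /nonsingular_ae/(_ h2); apply: filterS => t /=;
      rewrite face_lift0.
  by apply: nearW => a; apply: filterS aeN => t /=; rewrite face_ord0.
Qed.

Lemma ae_imp d (T : measurableType d) (R : realType)
    (m : {measure set T -> \bar R}) (P Q : set T) : (forall x, P x -> Q x) ->
  (\forall x \ae m, P x) -> \forall x \ae m, Q x.
Proof. exact: filterS. Qed.

Lemma nonsingular_comp d1 d2 d3 (T1 : measurableType d1)
    (T2 : measurableType d2) (T3 : measurableType d3) (R : realType)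
    (m1 : set T1 -> \bar R) (m2 : set T2 -> \bar R) (m3 : set T3 -> \bar R)
    (h : T2 -> T3) (k : T1 -> T2) :
  nonsingular m2 m3 h -> nonsingular m1 m2 k -> nonsingular m1 m3 (h \o k).
Proof.
move=> [mh h0] [mk k0]; split; first exact: measurableT_comp.
move=> N mN N0; apply: (k0 (h @^-1` N)); last exact: h0.
by rewrite -[X in measurable X]setTI; exact: mh.
Qed.

(** * Affine maps of [R^n] preserve null sets *)

(** For positive slope [u], the pushforward multiplied by [u] gives every interval its length and is
    therefore Lebesgue measure; a reflection covers negative slopes. *)
Lemma nonsingular_affine1 (R : realType) (s b : R) : s != 0 ->
  nonsingular (@lebesgue_measure R) (@lebesgue_measure R)
    ((fun x => s * x + b) : measurableTypeR R -> measurableTypeR R).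
Proof.
have mf (u v : R) : measurable_fun setT
    ((fun x => u * x + v) : measurableTypeR R -> measurableTypeR R).
  apply: measurable_funD => //; apply: measurable_funM => //.
have pos (u v : R) : 0 < u -> nonsingular (@lebesgue_measure R)
  (@lebesgue_measure R)
    ((fun x => u * x + v) : measurableTypeR R -> measurableTypeR R).
  move=> u0; split => // N mN N0.
  pose u' := NngNum (ltW u0).
  pose f : measurableTypeR R -> measurableTypeR R := fun x => u * x + v.
  have mfuv : measurable_fun setT f := mf u v.
  have [m mE] : exists m : {measure set (measurableTypeR R) -> \bar R},
      forall A, m A = (u%:E * lebesgue_measure (f @^-1` A))%E.
    by unshelve eexists (mscale u' (pushforward (@lebesgue_measure R) f)).
  have : lebesgue_measure N = m N.
    apply: lebesgue_measure_unique => // _ [[a c]] _ <-.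
    rewrite mE /f.
    rewrite (_ : _ @^-1` _ = `](a - v) / u, (c - v) / u]%classic); last first.
      apply/seteqP; split => x /=; rewrite !in_itv/= ltr_pdivrMr//
        ler_pdivlMr//.
        by rewrite ltrBlDr lerBrDr mulrC.
      by rewrite ltrBlDr lerBrDr mulrC.
    rewrite !lebesgue_measure_itv/= !lte_fin ltr_pM2r ?invr_gt0// ltrD2r.
    case: ifP => // _; last by rewrite mule0.
    rewrite -!EFinB -EFinM; congr (_%:E).
    by rewrite -mulrBl mulrCA mulfV ?gt_eqF// mulr1 opprB addrA subrK.
  rewrite N0 mE => /esym/eqP; rewrite mule_eq0 eqe gt_eqF//=.
  by move=> /eqP.
have neg : nonsingular (@lebesgue_measure R) (@lebesgue_measure R)
    (-%R : measurableTypeR R -> measurableTypeR R).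
  split=> [|N mN N0]; first exact: oppr_measurable.
  by have := lebesgue_measureN mN; rewrite /pushforward N0.
move=> s0; have [sgt|slt|s00] := ltgtP s 0;
  [|exact: pos|by rewrite s00 eqxx in s0].
rewrite (_ : (fun x => _) = (fun x => - s * x + b) \o -%R); last first.
  by apply/funext => x /=; rewrite mulrNN.
by apply: nonsingular_comp neg; apply: pos; rewrite oppr_gt0.
Qed.

Section Affine.
Variable R : realType.
Local Notation tR n := (n.-tuple (measurableTypeR R)).
Local Notation lebn n := (tuple_measure (@lebesgue_measure R) n).

Definition row_of_tuple n (x : tR n) : 'rV[R]_n := \row_j tnth x j.
Definition tuple_of_row n (v : 'rV[R]_n) : tR n := [tuple v 0 j | j < n].

Lemma row_of_tupleK n : cancel (@row_of_tuple n) (@tuple_of_row n).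
Proof. by move=> x; apply: eq_from_tnth => j; rewrite tnth_mktuple mxE. Qed.

Lemma tuple_of_rowK n : cancel (@tuple_of_row n) (@row_of_tuple n).
Proof. by move=> v; apply/rowP => j; rewrite mxE tnth_mktuple. Qed.

Definition affine n (M : 'M[R]_n) (b : 'rV[R]_n) (x : tR n) : tR n :=
  tuple_of_row (row_of_tuple x *m M + b).

Lemma measurable_affine n (M : 'M[R]_n) b : measurable_fun setT (affine M b).
Proof.
apply/measurable_fun_tnthP => j.
rewrite (_ : _ \o _ = fun x : tR n => \sum_i tnth x i * M i j + b 0 j).
  apply: measurable_funD => //; apply: measurable_sum => i.
  apply: measurable_funM => //; exact: measurable_tnth.
apply/funext => x /=; rewrite tnth_mktuple mxE mxE.
by congr (_ + _); apply: eq_bigr => i _; rewrite mxE.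
Qed.

Lemma affine_comp n (M M' : 'M[R]_n) b b' :
  affine M' b' \o affine M b = affine (M *m M') (b *m M' + b').
Proof.
by apply/funext => x; rewrite /= /affine tuple_of_rowK mulmxDl mulmxA addrA.
Qed.

Lemma row_of_tuple_cons n a (t : tR n) :
  row_of_tuple (cons_tuple a t) = row_mx a%:M (row_of_tuple t) :> 'rV_(1 + n).
Proof.
apply/rowP => j; rewrite mxE; case: (split_ordP j) => k ->.
  rewrite row_mxEl mxE.
  have -> : lshift n k = ord0 :> 'I_n.+1 by apply/val_inj; rewrite /= (ord1 k).
  by rewrite tnth0 (ord1 k) eqxx.
rewrite row_mxEr mxE.
have -> : rshift 1 k = lift ord0 k :> 'I_n.+1 by apply/val_inj.
by rewrite tnthS.
Qed.

Lemma tuple_of_row_cons n a (v : 'rV[R]_n) :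
  tuple_of_row (row_mx a%:M v : 'rV_(1 + n)) = cons_tuple a (tuple_of_row v).
Proof.
by apply: (can_inj (@row_of_tupleK _)); rewrite row_of_tuple_cons
  !tuple_of_rowK.
Qed.

(* With [D] invertible, [u = x0 r + x' D + v'] may replace [x'] for fixed [x0];
   the first coordinate of the image is then affine in [x0], with the Schur
   complement [S] of [D] as slope. *)
Lemma nonsingular_affine_block n (M : 'M[R]_(1 + n)) b :
  (forall (D : 'M[R]_n) v, D \in unitmx ->
     nonsingular (lebn n) (lebn n) (affine D v)) ->
  M \in unitmx -> drsubmx M \in unitmx ->
  nonsingular (lebn (1 + n)) (lebn (1 + n)) (affine M b).
Proof.
move=> IH Mu Du; split; first exact: measurable_affine.
set D := drsubmx M in Du *; set c := dlsubmx M; set r := ursubmx M.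
set a := ulsubmx M; pose S := a - r *m invmx D *m c.
have S0 : S 0 0 != 0.
  (* Block elimination, whence [det M] is [S 0 0] times [det D]. *)
  have : block_mx 1%:M (r *m invmx D) 0 1%:M *m block_mx S 0 c D = M.
    rewrite mulmx_block !mul0mx !mul1mx ?mulmx1 ?mulmx0 !add0r.
    by rewrite /S subrK mulmxKV// -[RHS]submxK.
  move/(congr1 determinant); rewrite det_mulmx det_ublock det_lblock !det1
    !mul1r.
  move=> e; move: Mu; rewrite unitmxE -e unitrM => /andP[+ _].
  by rewrite {1}[S]mx11_scalar det_scalar1 unitfE.
pose v0 := (lsubmx b) 0 0; pose v' := rsubmx b.
pose beta (u : tR n) := ((row_of_tuple u - v') *m invmx D *m c) 0 0 + v0.
have affE x0 (t : tR n) :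
    affine M b (cons_tuple x0 t) =
    cons_tuple (S 0 0 * x0 + beta (affine D (x0 *: r + v') t))
      (affine D (x0 *: r + v') t).
  have -> : affine M b (cons_tuple x0 t) =
    tuple_of_row (row_mx (S 0 0 * x0 + beta (affine D (x0 *: r + v') t))%:M
      (row_of_tuple t *m D + (x0 *: r + v')) : 'rV_(1 + n)); last first.
    by rewrite tuple_of_row_cons.
  rewrite /affine row_of_tuple_cons; congr tuple_of_row.
  rewrite -[M]submxK -[b]hsubmxK mul_row_block add_row_mx -/D -/c -/r -/a.
  rewrite !mul_scalar_mx; congr row_mx; last first.
    by rewrite [x0 *: r + _ in LHS]addrC -addrA.
  rewrite [LHS]mx11_scalar; congr (_%:M).
  rewrite /beta /affine tuple_of_rowK.
  have -> : row_of_tuple t *m D + (x0 *: r + v') - v' =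
            row_of_tuple t *m D + x0 *: r by rewrite addrA addrK.
  rewrite 2!mulmxDl mulmxK// -!scalemxAl /S !mxE -/v0.
  have -> : b 0 (lshift n 0) = v0 by rewrite /v0 mxE.
  ring.
have mbeta : measurable_fun setT (fun p : measurableTypeR R * tR n =>
    cons_tuple (S 0 0 * p.1 + beta p.2) p.2).
  have mb : measurable_fun setT beta.
    rewrite (_ : beta = fun u : tR n => (\sum_j (tnth u j - v' 0 j) *
        (invmx D *m c) j 0) + v0).
      apply: measurable_funD => //.
      apply: measurable_sum => j; apply: measurable_funM => //.
      apply: measurable_funB => //; exact: measurable_tnth.
    apply/funext => u; rewrite /beta -mulmxA mxE; congr (_ + _).
    by apply: eq_bigr => j _; rewrite !mxE.
  apply: (measurable_cons _ measurable_snd).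
  apply: measurable_funD.
    by apply: measurable_funM => //; exact: measurable_fst.
  exact: measurableT_comp.
move=> N mN N0; apply: tuple_measure_null.
  by rewrite -[X in measurable X]setTI; exact: measurable_affine.
(* For fixed [u] the first coordinate is affine in [x0] with slope [S 0 0], so the one-dimensional
   case applies; Fubini then lets [x0] be fixed, and the induction hypothesis substitutes
   [u = affine D (x0 *: r + v') t]. *)
have swap : \forall x0 \ae @lebesgue_measure R, \forall u \ae lebn n,
    ~ N (cons_tuple (S 0 0 * x0 + beta u) u).
  apply: (ae_swap (m1 := lebn n) (m2 := @lebesgue_measure R)
    (E := [set p | ~ N (cons_tuple (S 0 0 * p.2 + beta p.1) p.1)])).
    apply: measurableC; rewrite -[X in measurable X]setTI.
    have := measurableT_comp mbeta (@measurable_swap _ _ (tR n)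
      (measurableTypeR R)).
    exact.
  have : \forall x \ae lebn n.+1, ~ N x by exists N; split => // x /contrapT.
  move=> /ae_tuple_cons.
  move=> /(ae_swap (m1 := @lebesgue_measure R) (m2 := lebn n)
            (E := [set p | ~ N (cons_tuple p.1 p.2)])) aeu.
  have : \forall u \ae lebn n, \forall x \ae @lebesgue_measure R,
      ~ N (cons_tuple x u).
    apply: aeu; apply: measurableC; rewrite -[X in measurable X]setTI.
    exact: mcons2.
  apply: filterS => u hu.
  exact: (nonsingular_ae (nonsingular_affine1 (beta u) S0) hu).
apply: ae_imp swap => x0 hx0.
apply: filterS (nonsingular_ae (IH D (x0 *: r + v') Du) hx0) => t.
by rewrite /= affE.
Qed.

(** Induction on [n] through the lower right block. If that block is singular, [M] is the product of
    [M *m E] and the shear [E'], and both factors have invertible lower right blocks. *)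
Lemma nonsingular_affine n (M : 'M[R]_n) b : M \in unitmx ->
  nonsingular (lebn n) (lebn n) (affine M b).
Proof.
elim: n M b => [|n IH] M b Mu.
  rewrite (_ : affine M b = id).
    by split => [|N mN N0]; [exact: measurable_id|].
  by apply/funext => x; rewrite (tuple0 x) tuple0.
have [Du|Dn] := boolP (@drsubmx _ 1 n 1 n M \in unitmx).
  exact: nonsingular_affine_block.
pose D := @drsubmx _ 1 n 1 n M; pose c := @dlsubmx _ 1 n 1 n M.
have eM : M = block_mx (@ulsubmx _ 1 n 1 n M) (@ursubmx _ 1 n 1 n M) c D.
  by rewrite submxK.
have /det0P[z z0 zD] : \det D^T == 0.
  by rewrite det_tr; move: Dn; rewrite unitmxE unitfE negbK.
have /rV0Pn[j zj] := z0.
(* Adding [x0] to [x_j] makes the lower right block [D + c e_j] invertible. *)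
pose E : 'M[R]_(1 + n) := block_mx 1%:M (delta_mx 0 j) 0 1%:M.
pose E' : 'M[R]_(1 + n) := block_mx 1%:M (- delta_mx 0 j) 0 1%:M.
have uE (e : 'rV[R]_n) : block_mx 1%:M e 0 1%:M \in @unitmx R (1 + n).
  by rewrite unitmxE det_ublock !det1 mulr1 unitr1.
have EE' : E *m E' = 1%:M.
  rewrite mulmx_block !mul0mx !mulmx0 !mul1mx !mulmx1 !addr0 addNr add0r.
  by rewrite -scalar_mx_block.
have -> : affine M b = affine E' b \o affine ((M : 'M[R]_(1 + n)) *m E) (0 :
  'rV_(1 + n)).
  by rewrite affine_comp -mulmxA EE' mulmx1 mul0mx add0r.
apply: nonsingular_comp; apply: nonsingular_affine_block => //.
- exact: uE.
- by rewrite block_mxKdr unitmx1.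
- by rewrite unitmx_mul Mu uE.
rewrite eM mulmx_block !mulmx0 !mulmx1 addr0 block_mxKdr.
rewrite unitmxE unitfE; apply/negP => /det0P[k k0].
rewrite mulmxDr mulmxA => kM.
(* Multiplying by the kernel vector [z] of [D] isolates [c]: as [z 0 j != 0], it gives [k c = 0],
   hence [k D = 0], and the nonzero row [(0, k)] would be killed by [M]. *)
have kc : k *m c = 0.
  have := congr1 (mulmx^~ z^T) kM; rewrite mul0mx mulmxDl -!mulmxA.
  have -> : D *m z^T = 0 by rewrite -[D]trmxK -trmx_mul zD trmx0.
  rewrite mulmx0 addr0 mulmxA => /matrixP/(_ 0 0);
    rewrite mxE big_ord1 [RHS]mxE.
  have -> : (delta_mx 0 j *m z^T : 'M[R]_1) 0 0 = z 0 j.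
    by rewrite -rowE !mxE.
  move=> /eqP; rewrite mulf_eq0 (negbTE zj) orbF => /eqP h.
  by rewrite [LHS]mx11_scalar h; apply/matrixP => i i'; rewrite !mxE mul0rn.
have kD : k *m D = 0 by move: kM; rewrite kc mul0mx add0r.
have : row_mx (0 : 'rV[R]_1) k *m (M : 'M[R]_(1 + n)) = 0.
  by rewrite eM mul_row_block !mul0mx !add0r kc kD row_mx0.
move/(congr1 (mulmx^~ (invmx (M : 'M[R]_(1 + n))))); rewrite mulmxK// mul0mx.
by rewrite -row_mx0 => /eq_row_mx[_ /eqP]; rewrite (negbTE k0).
Qed.
End Affine.

(** * Linear maps, hyperplanes, and complex vectors as real tuples *)

Section LinearMaps.
Variable R : realType.
Local Notation tR n := (n.-tuple (measurableTypeR R)).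
Local Notation lebn n := (tuple_measure (@lebesgue_measure R) n).

Lemma nonsingular_linear n (f : 'rV[R]_n -> 'rV[R]_n) :
  linear f -> injective f ->
  nonsingular (lebn n) (lebn n)
    (fun x : tR n => tuple_of_row (f (row_of_tuple x))).
Proof.
move=> lf injf; pose F : {linear 'rV[R]_n -> 'rV[R]_n} :=
  HB.pack f (GRing.isLinear.Build _ _ _ _ f lf).
have -> : (fun x : tR n => tuple_of_row (f (row_of_tuple x))) =
    affine (lin1_mx F) 0.
  by apply/funext => x; rewrite /affine mul_rV_lin1 addr0.
apply: nonsingular_affine; rewrite unitmxE unitfE; apply/negP => /det0P[v v0].
rewrite mul_rV_lin1 -(linear0 F) => /injf /eqP; exact/negP.
Qed.

(** If a later coefficient is nonzero, every slice by the first coordinate is again a hyperplane;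
    otherwise the hyperplane fixes the first coordinate to one value, and a point is null. *)
Lemma ae_neq_row n (a : 'I_n -> R) (b : R) : (exists i, a i != 0) ->
  \forall x \ae lebn n, \sum_i tnth x i * a i != b.
Proof.
elim: n a b => [|n IH] a b [i ai]; first by case: i ai.
have mE k (c : 'I_k -> R) e :
    measurable [set x : tR k | \sum_i tnth x i * c i = e].
  have mf : measurable_fun setT (fun x : tR k => \sum_i tnth x i * c i).
    apply: measurable_sum => j; apply: measurable_funM => //.
    exact: measurable_tnth.
  rewrite (_ : mkset _ = setT `&` (fun x : tR k => \sum_i tnth x i * c i) @^-1`
    [set e]).
    exact: mf.
  by rewrite setTI.
exists [set x : tR n.+1 | \sum_i tnth x i * a i = b]; split.
- exact: mE.
- apply: tuple_measure_null; first exact: mE.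
  have e x0 (t : tR n) : \sum_i tnth (cons_tuple x0 t) i * a i =
      x0 * a ord0 + \sum_i tnth t i * a (lift ord0 i).
    rewrite big_ord_recl tnth0; congr (_ + _).
    by apply: eq_bigr => j _; rewrite tnthS.
  have [[j aj]|] := pselect (exists j, a (lift ord0 j) != 0).
    apply: nearW => x0.
    have := IH (fun j => a (lift ord0 j)) (b - x0 * a ord0).
    move=> /(_ (ex_intro _ j aj)); apply: ae_imp => t /eqP h /=.
    by rewrite e => hb; apply: h; rewrite -hb addrAC subrr add0r.
  move=> /forallNP a0; have {}a0 j : a (lift ord0 j) = 0.
    by have /negP := a0 j; rewrite negbK => /eqP.
  have {}ai : a ord0 != 0 by case: (unliftP ord0 i) ai => [j ->|->//];
    rewrite a0 eqxx.
  exists [set b / a ord0]; split; [exact: measurable_set1|exact: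
    lebesgue_measure_set1|].
  move=> x0 /= h; apply: contrapT => nx; apply: h; apply: nearW => t.
  rewrite e big1 ?addr0; last by move=> j _; rewrite a0 mulr0.
  by move=> h; apply: nx; rewrite -h mulfK.
- by move=> x /= /negP; rewrite negbK => /eqP.
Qed.

Definition cvec n (t : tR (n + n)) : 'cV[R[i]]_n :=
  \col_j Complex (tnth t (lshift n j)) (tnth t (rshift n j)).

Definition tuple_of_cvec n (v : 'cV[R[i]]_n) : tR (n + n) :=
  [tuple match fintype.split i with
         | inl j => complex.Re (v j 0) | inr j => complex.Im (v j 0) end
   | i < n + n].

Lemma cvecK n : cancel (@cvec n) (@tuple_of_cvec n).
Proof.
move=> t; apply: eq_from_tnth => i; rewrite tnth_mktuple.
by case: split_ordP => j ->; rewrite mxE.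
Qed.

Lemma tuple_of_cvecK n : cancel (@tuple_of_cvec n) (@cvec n).
Proof.
move=> v; apply/colP => j; rewrite mxE !tnth_mktuple.
rewrite (_ : fintype.split (lshift n j) = inl j);
  last exact: (unsplitK (inl j)).
rewrite (_ : fintype.split (rshift n j) = inr j);
  last exact: (unsplitK (inr j)).
by case: (v j 0).
Qed.

Lemma cvec_linear n (k : R) (u v : 'rV[R]_(n + n)) :
  cvec (tuple_of_row (k *: u + v)) =
  Complex k 0 *: cvec (tuple_of_row u) + cvec (tuple_of_row v).
Proof.
apply/colP => j; rewrite !mxE !tnth_mktuple !mxE.
by apply/eqP; rewrite eq_complex /= !mul0r subr0 addr0 !eqxx.
Qed.

Lemma tuple_of_cvec_linear n (k : R) (u v : 'cV[R[i]]_n) :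
  row_of_tuple (tuple_of_cvec (Complex k 0 *: u + v)) =
  k *: row_of_tuple (tuple_of_cvec u) + row_of_tuple (tuple_of_cvec v).
Proof.
apply/rowP => j; rewrite !mxE !tnth_mktuple.
case: fintype.split => i; rewrite !mxE; case: (u i 0) (v i 0) => a b [c d] /=.
  by rewrite mul0r subr0.
by rewrite mul0r addr0.
Qed.

Lemma nonsingular_mulmx n (g : 'M[R[i]]_n) : g \in unitmx ->
  nonsingular (lebn (n + n)) (lebn (n + n))
    (fun x => tuple_of_cvec (g *m cvec x)).
Proof.
move=> gu; pose f (u : 'rV[R]_(n + n)) :=
  row_of_tuple (tuple_of_cvec (g *m cvec (tuple_of_row u))).
have := @nonsingular_linear (n + n) f.
have -> : (fun x : tR (n + n) => tuple_of_row (f (row_of_tuple x))) =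
          fun x => tuple_of_cvec (g *m cvec x).
  by apply/funext => x; rewrite /f !row_of_tupleK.
apply.
- move=> k u v; rewrite /f cvec_linear mulmxDr -scalemxAr.
  exact: tuple_of_cvec_linear.
- move=> u v /(can_inj (@row_of_tupleK _ _))/(can_inj (@tuple_of_cvecK n)).
  move=> /(congr1 (mulmx (invmx g))); rewrite !mulKmx//.
  by move=> /(can_inj (@cvecK n))/(can_inj (@tuple_of_rowK _ _)).
Qed.

(** A complex hyperplane lies in a real one: after division of [w] by a nonzero entry [w 0 j], the
    real part of the pairing is a real linear form with coefficient 1 at the real part of entry
    [j]. *)
Lemma ae_cvec_neq0 n (w : 'rV[R[i]]_n) : w != 0 ->
  \forall x \ae lebn (n + n), w *m cvec x != 0.
Proof.
move=> /rV0Pn[j wj].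
have [c [c0 cw]] : exists c : R[i], [/\ True & c * w 0 j = 1].
  by exists (w 0 j)^-1; split => //; rewrite mulVf.
pose a (i : 'I_(n + n)) := match fintype.split i with
  | inl k => complex.Re (c * w 0 k) | inr k => - complex.Im (c * w 0 k) end.
have ha : exists i, a i != 0.
  exists (lshift n j); rewrite /a.
  rewrite (_ : fintype.split (lshift n j) = inl j);
    last exact: (unsplitK (inl j)).
  by rewrite cw /= oner_eq0.
have := ae_neq_row 0 ha; apply: ae_imp => x; apply: contraNN => /eqP wx.
have : complex.Re ((c *: (w *m cvec x)) 0 0) = 0 by rewrite wx scaler0 mxE.
rewrite scalemxAl mxE raddf_sum/= big_split_ord/= => e.
apply/eqP; rewrite -[RHS]e -big_split/=.
apply: eq_bigr => k _; rewrite /a.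
rewrite (_ : fintype.split (lshift n k) = inl k);
  last exact: (unsplitK (inl k)).
rewrite (_ : fintype.split (rshift n k) = inr k);
  last exact: (unsplitK (inr k)).
rewrite !mxE; case: (c * w 0 k) => p q /=; ring.
Qed.

End LinearMaps.

(** * Measurability and null sets in the projective space *)

Lemma normc_le (R : rcfType) (z : R[i]) :
  `|z| <= (`|complex.Re z| + `|complex.Im z|)%:C%C.
Proof.
rewrite {1}[z]complexE (le_trans (ler_normD _ _))// normrM.
have n r : `|r%:C%C| = `|r|%:C%C :> R[i] by rewrite normc_def/= expr0n addr0
  sqrtr_sqr.
by rewrite !n normc_def/= expr0n/= add0r expr1n sqrtr1 mul1r -rmorphD.
Qed.

Section Measurability.
Variable R : realType.
Local Notation tR n := (n.-tuple (measurableTypeR R)).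

Lemma measurable_cvec_open n (O : set 'cV[R[i]]_n) : open O ->
  measurable (@cvec R n @^-1` O).
Proof.
move=> oO.
pose box (p : {ffun 'I_(n + n) -> rat} * nat) : set (tR (n + n)) :=
  [set y | forall i, `|tnth y i - ratr (p.1 i)| < p.2.+1%:R^-1].
pose J : Type := {p : {ffun 'I_(n + n) -> rat} * nat | `[< box p `<=` @cvec R n
  @^-1` O >]}.
rewrite (_ : _ @^-1` _ = \bigcup_(p : J) box (val p)).
  apply: countable_bigcupT_measurable; first exact: countableP.
  move=> [[q k] _] /=.
  rewrite (_ : box _ = \bigcap_(i in [set: 'I_(n + n)])
    (fun y : tR (n + n) => tnth y i) @^-1` ball (ratr (q i) : R) k.+1%:R^-1).
    apply: fin_bigcap_measurable => // i _.
    rewrite -[X in measurable X]setTI; apply: measurable_tnth => //.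
    exact: measurable_ball.
  apply/seteqP; split=> y /= h i; last first.
    by move: (h i I); rewrite /ball/= distrC.
  by move=> _; move: (h i); rewrite /ball/= distrC.
apply/seteqP; split => [y Oy|y [[p hp] _ /=]]; last exact: (asboolW hp).
have /nbhs_ballP[e /= e0 he] : nbhs (cvec y) O.
  by have := oO; rewrite openE; apply.
have e0' : 0 < complex.Re e by move: e0; rewrite ltcE /= => /andP[_].
(* Radii of balls are elements of [R[i]], and a positive one is real. *)
have eE : e = (complex.Re e)%:C%C.
  move: e0; rewrite ltcE /= => /andP[/eqP + _].
  by case: (e) => a b /= ->.
(* Two points of a box of half-side [1 / (k + 1)] differ by less than [2 / (k + 1)] in each real
   coordinate, and the modulus of an entry is at most the sum over its two parts: hence 4. *)
have [k] := ltr_add_invr (y := 0) (x := complex.Re e / 4) (divr_gt0 e0' (ltr0n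
  _ 4)).
rewrite add0r => hk.
have hq i : {q : rat | `|tnth y i - ratr q| < k.+1%:R^-1}.
  apply: cid; have : tnth y i - k.+1%:R^-1 < tnth y i + k.+1%:R^-1.
    by rewrite ltrD2l gtrN// invr_gt0.
  move=> /rat_in_itvoo[q]; rewrite in_itv/= => /andP[q1 q2]; exists q.
  by rewrite distrC ltr_distl q1.
pose q := [ffun i => sval (hq i)].
have qb : box (q, k) `<=` @cvec R n @^-1` O.
  move=> z hz; apply: he; split => // i j; rewrite /ball/= !mxE.
  have d l : `|tnth y l - tnth z l| < 2 * k.+1%:R^-1.
    have := hz l; rewrite /= ffunE; have := svalP (hq l); set r := ratr _.
    by rewrite distrC => h1 h2; rewrite mulr2n mulrDl mul1r (le_lt_trans
      (ler_distD r _ _))// ltrD// distrC.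
  apply: le_lt_trans (normc_le _) _.
  rewrite eE ltcR; apply: lt_trans (ltrD (d (lshift n i)) (d (rshift n i))) _.
  rewrite (_ : _ + _ = k.+1%:R^-1 * 4); last by ring.
  by rewrite -ltr_pdivlMr.
exists (exist _ (q, k) (asboolT qb)) => //= i.
by rewrite ffunE; exact: svalP (hq i).
Qed.

Lemma measurable_proj : measurable_fun setT (fun y => proj (@cvec R 4 y)).
Proof.
have m0 : measurable (@cvec R 4 @^-1` [set v | v != 0]).
  apply: measurable_cvec_open.
  rewrite (_ : mkset _ = [set v | v != 0 /\ setT (proj v)]).
    exact: (@projective_openT R).
  by apply/seteqP; split => v /= => [|[]].
apply: (measurability [set U : set (projective R) | open U]) => // _ [U oU <-];
  rewrite setTI.
(* On nonzero vectors the preimage is open by definition of the quotient topology; the zero vector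
   belongs to the preimage exactly when [U] contains the dummy point [proj 0]. *)
rewrite (_ : _ @^-1` _ = @cvec R 4 @^-1` [set v | v != 0 /\ U (proj v)] `|`
   (~` (@cvec R 4 @^-1` [set v | v != 0]) `&` [set _ | U (proj 0)]));
     last first.
  apply/seteqP; split => y /=.
    have [->|v0] := eqVneq (cvec y) 0; last by left.
    by right; split => //; rewrite eqxx.
  by move=> [[]//|[/negP]]; rewrite negbK => /eqP ->.
apply: measurableU; first exact: measurable_cvec_open.
apply: measurableI; first exact: measurableC.
have [h|h] := pselect (U (proj 0)).
  by rewrite (_ : mkset _ = setT)//; apply/seteqP; split.
by rewrite (_ : mkset _ = set0)//; apply/seteqP; split.
Qed.

End Measurability.

Lemma projZ (R : realType) (z : R[i]) (v : C4 R) : z != 0 -> proj (z *: v) =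
  proj v.
Proof.
move=> z0; rewrite /Defs.proj; congr insubd; apply/eqP; rewrite eqEsubv -!memvE.
rewrite memvZ ?memv_line//=; rewrite -{1}[v](scalerK z0).
by rewrite memvZ ?memv_line.
Qed.

Lemma tuple_measure_null2 d (T : measurableType d) (R : realType)
    (mu : {sigma_finite_measure set T -> \bar R}) n (N : set (n.+2.-tuple T)) :
  measurable N ->
  (\forall a \ae mu, forall b, \forall t \ae tuple_measure mu n,
     ~ N (cons_tuple a (cons_tuple b t))) ->
  tuple_measure mu n.+2 N = 0%E.
Proof.
move=> mN h; apply: tuple_measure_null => //; apply: ae_imp h => a ha.
have mNa : measurable [set t | N (cons_tuple a t)].
  rewrite -[X in measurable X]setTI.
  exact: (measurable_cons (measurable_cst a) (@measurable_id _ _ setT)).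
exists [set t | N (cons_tuple a t)]; split => //; last by move=> t /= /contrapT.
by apply: tuple_measure_null => //; exact: nearW.
Qed.

(* Almost every vector [(a + ib, z)] of [V] has [a <> 0], and spans the point of
   the chart 0 with coordinates [z / (a + ib)]; so that one chart suffices. *)
Section Cone.
Variable R : realType.
Local Notation tR n := (n.-tuple (measurableTypeR R)).
Local Notation lebn n := (tuple_measure (@lebesgue_measure R) n).

(** The permutation that brings the real and imaginary parts of entry 0, at places 0 and 4 for
    [cvec], to the front. The other six coordinates then come in the order used by [chart]. *)
Let to_chart (i : 'I_(3 + 3).+2) : 'I_(4 + 4) :=
  @inord 7 (nth 0%N [:: 0; 4; 1; 2; 3; 5; 6; 7]%N i).
Let of_chart (i : 'I_(4 + 4)) : 'I_(3 + 3).+2 :=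
  @inord 7 (nth 0%N [:: 0; 2; 3; 4; 1; 5; 6; 7]%N i).

Let to_chartK : cancel to_chart of_chart.
Proof.
case=> i hi; apply/val_inj; rewrite /of_chart /to_chart /=.
by do 8?[case: i hi => [|i] hi; first by rewrite !inordK].
Qed.

Let of_chartK : cancel of_chart to_chart.
Proof.
case=> i hi; apply/val_inj; rewrite /of_chart /to_chart /=.
by do 8?[case: i hi => [|i] hi; first by rewrite !inordK].
Qed.

Let to_cone (s : tR (3 + 3).+2) : tR (4 + 4) :=
  [tuple tnth s (of_chart i) | i < 4 + 4].

Let nonsingular_reindex m n (p : 'I_m -> 'I_n) (q : 'I_n -> 'I_m) : n = m ->
  cancel q p ->
  nonsingular (lebn n) (lebn m) (fun s : tR n => [tuple tnth s (p i) | i < m]).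
Proof.
move=> e; case: m / e p q => p q pq.
pose f (r : 'rV[R]_n) : 'rV[R]_n := \row_i r 0 (p i).
have -> : (fun s : tR n => [tuple tnth s (p i) | i < n]) =
    fun s : tR n => tuple_of_row (f (row_of_tuple s)).
  by apply/funext => s; apply: eq_from_tnth => i; rewrite !tnth_mktuple !mxE.
apply: nonsingular_linear.
  by move=> k u v; apply/rowP => i; rewrite !mxE.
by move=> u v /rowP e; apply/rowP => i; have := e (q i); rewrite !mxE pq.
Qed.

Let cone (s : tR (3 + 3).+2) : 'cV[R[i]]_4 :=
  \col_(k < 4) if unlift (0 : 'I_4) k is Some j
         then Complex (tnth s (lift ord0 (lift ord0 (lshift 3 j))))
                      (tnth s (lift ord0 (lift ord0 (rshift 3 j))))
         else Complex (tnth s ord0) (tnth s (lift ord0 ord0)).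

Let cvec_to_cone s : @cvec R 4 (to_cone s) = cone s.
Proof.
apply/colP => k; rewrite !mxE !tnth_mktuple.
have e (i j : 'I_(3 + 3).+2) : val i = val j -> tnth s i = tnth s j.
  by move=> h; congr tnth; apply: val_inj.
case: (unliftP 0 k) => [j ->|->]; congr Complex; apply: e;
  rewrite /of_chart /= ?inordK//.
- by case: j => -[|[|[|]]].
- by case: j => -[|[|[|]]].
- by case: j => -[|[|[|]]].
by case: j => -[|[|[|]]].
Qed.

Let cone_cons a b (t : tR (3 + 3)) : cone (cons_tuple a (cons_tuple b t)) =
  \col_(k < 4) if unlift (0 : 'I_4) k is Some j then cvec t j 0 else Complex a
    b.
Proof.
by apply/colP => k; rewrite !mxE; case: unliftP => [j _|_];
  rewrite ?mxE !tnthS ?tnth0.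
Qed.

Lemma nonsingular_proj (mu : {sigma_finite_measure set (projective R) -> \bar
  R}) :
  smooth_measure_class mu ->
  nonsingular (lebn (4 + 4)) mu (fun y => proj (@cvec R 4 y)).
Proof.
move=> smu; split=> [|N mN N0]; first exact: measurable_proj.
pose to_c (s : tR (4 + 4)) : tR (3 + 3).+2 :=
  [tuple tnth s (to_chart i) | i < (3 + 3).+2].
have -> : (fun y => proj (@cvec R 4 y)) @^-1` N = to_c @^-1` ((fun s => proj
  (cone s)) @^-1` N).
  apply/seteqP; split=> y /=; rewrite -cvec_to_cone /to_cone.
    by rewrite (_ : [tuple _ | i < 4 + 4] = y)//; apply: eq_from_tnth => i;
      rewrite !tnth_mktuple of_chartK.
  by rewrite (_ : [tuple _ | i < 4 + 4] = y)//; apply: eq_from_tnth => i;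
    rewrite !tnth_mktuple of_chartK.
have mcone : measurable_fun setT (fun s => proj (cone s)).
  rewrite (_ : (fun s => _) = (fun y => proj (@cvec R 4 y)) \o to_cone).
    apply: measurableT_comp; first exact: measurable_proj.
    exact: (nonsingular_reindex erefl to_chartK).1.
  by apply/funext => s /=; rewrite cvec_to_cone.
apply: (nonsingular_reindex erefl of_chartK).2.
  by rewrite -[X in measurable X]setTI; exact: mcone.
have mN' : measurable ((fun s => proj (cone s)) @^-1` N).
  by rewrite -[X in measurable X]setTI; exact: mcone.
apply: (tuple_measure_null2 mN').
have chart0 : lebn (3 + 3) (chart 0 @^-1` N) = 0%E by exact: (smu N mN).1.
have Nchart : \forall t \ae lebn (3 + 3), ~ (chart 0 @^-1` N) t.
  exists (chart 0 @^-1` N); split; [|exact: chart0|by move=> t /= /contrapT].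
  rewrite (_ : chart 0 = (fun s => proj (cone s)) \o
                         (fun t => cons_tuple 1 (cons_tuple 0 t))).
    rewrite -[X in measurable X]setTI; apply: (measurableT_comp mcone) => //.
    apply: (measurable_cons (measurable_cst _)).
    exact: (measurable_cons (measurable_cst _) (@measurable_id _ _ setT)).
  apply/funext => t; rewrite /= cone_cons; congr proj; apply/colP => k.
  by rewrite !mxE; case: unliftP => // j _; rewrite mxE.
(* For [a != 0] the entry [z = a + ib] is nonzero whatever [b] is, and multiplication by [z^-1],
   which is nonsingular, turns the remaining entries into chart coordinates. *)
exists [set (0 : R)]; split; [exact: measurable_set1|exact:
  lebesgue_measure_set1|].
move=> a /= ha; apply: contrapT => /eqP a0; apply: ha => b.
pose z : R[i] := Complex a b.
have z0 : z != 0 by rewrite eq_complex /= negb_and a0.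
have zu : (z^-1)%:M \in @unitmx R[i] 3.
  by rewrite unitmxE det_scalar unitrX// unitfE invr_eq0.
have := nonsingular_ae (nonsingular_mulmx zu) Nchart.
rewrite /preimage/=; apply: ae_imp => t; set u := tuple_of_cvec _.
suff -> : proj (cone (cons_tuple a (cons_tuple b t))) = chart 0 u by [].
have -> : chart 0 u = proj (\col_(k < 4) if unlift (0 : 'I_4) k is Some j
    then z^-1 * cvec t j 0 else 1).
  congr proj; apply/colP => k; rewrite !mxE; case: unliftP => // j _.
  have : cvec u j 0 = z^-1 * cvec t j 0.
    by rewrite tuple_of_cvecK mul_scalar_mx mxE.
  by rewrite mxE.
rewrite cone_cons -[RHS](projZ _ z0); congr proj; apply/colP => k; rewrite !mxE.
by case: unliftP => [j _|_]; rewrite ?mulVKf ?mulr1.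
Qed.

End Cone.

(** * Frames attached to four vectors *)

Lemma sum4 (V : nmodType) (F : 'I_4 -> V) :
  \sum_i F i = F 0 + F 1 + F 2 + F 3.
Proof.
rewrite !big_ord_recl big_ord0 addr0 !addrA.
by congr (_ + F _ + F _ + F _); apply: val_inj.
Qed.

Lemma ord4 (i : 'I_4) : [\/ i = 0, i = 1, i = 2 | i = 3].
Proof.
by case: i => -[|[|[|[|]]]]// h; [apply: Or41|apply: Or42|apply: Or43|apply:
  Or44];
  exact: val_inj.
Qed.

Section Frames.
Variables (K : fieldType) (V : vectType K) (w : V -> V -> K).
Hypothesis dimV : \dim (fullv : {vspace V}) = 4.
Hypotheses (wD : forall x y z, w (x + y) z = w x z + w y z)
  (wDr : forall x y z, w x (y + z) = w x y + w x z)
  (wZ : forall a x y, w (a *: x) y = a * w x y)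
  (w_alt : forall x, w x x = 0).
Implicit Types (x y z : V).

Lemma alternatingC x y : w x y = - w y x.
Proof.
apply/eqP; rewrite -addr_eq0; apply/eqP.
have := w_alt (x + y); rewrite wD !wDr !w_alt.
by rewrite add0r addr0.
Qed.

Let wZr a x y : w x (a *: y) = a * w x y.
Proof. by rewrite alternatingC wZ [w x y]alternatingC mulrN. Qed.

Let wN x y : w (- x) y = - w x y.
Proof. by rewrite -scaleN1r wZ mulN1r. Qed.

Let wNr x y : w x (- y) = - w x y.
Proof. by rewrite -scaleN1r wZr mulN1r. Qed.

Let w0 y : w 0 y = 0.
Proof. by rewrite -(scale0r 0) wZ mul0r. Qed.

Definition form_scal v1 v2 v3 := w v1 v2 * w v1 v3 * w v2 v3.
Definition radical v1 v2 v3 := w v2 v3 *: v1 - w v1 v3 *: v2 + w v1 v2 *: v3.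
(** Expands to [w12 w34 - w13 w24 + w14 w23], the Pfaffian of the Gram matrix of the four
    vectors. *)
Definition pfaff v1 v2 v3 v4 := w (radical v1 v2 v3) v4.

(* [radical v1 v2 v3] is orthogonal to [v1], [v2] and [v3], and the last vector is
   a multiple of [v4] made orthogonal to [v1] and [v2].  The scalings make the
   frame consist of two hyperbolic pairs with the same pairing. *)
Definition frame v1 v2 v3 v4 (j : 'I_4) : V :=
  nth 0 [:: pfaff v1 v2 v3 v4 *: (w v2 v3 *: v1);
            pfaff v1 v2 v3 v4 *: (w v1 v3 *: v2);
            pfaff v1 v2 v3 v4 *: radical v1 v2 v3;
            form_scal v1 v2 v3 *: v4 - (w v2 v3 * w v1 v4 * w v1 v3) *: v2
            + (w v1 v3 * w v2 v4 * w v2 v3) *: v1] j.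

Definition frame_scal v1 v2 v3 v4 := form_scal v1 v2 v3 * pfaff v1 v2 v3 v4 ^+
  2.

Definition darboux (c : K) (e : 'I_4 -> V) :=
  [/\ w (e 0) (e 1) = c, w (e 2) (e 3) = c,
      w (e 0) (e 2) = 0, w (e 0) (e 3) = 0 & w (e 1) (e 2) = 0 /\ w (e 1) (e 3)
        = 0].

(** In the pairing of [e 0] with [e 1] the Pfaffian comes squared from the scalings; in that of
    [e 2] with [e 3] it comes once from the scaling and once as [w (radical v1 v2 v3) v4]. *)
Lemma darboux_frame v1 v2 v3 v4 :
  darboux (frame_scal v1 v2 v3 v4) (frame v1 v2 v3 v4).
Proof.
rewrite /darboux /frame /frame_scal /=; set pf := pfaff _ _ _ _.
have pfE : pf = w v2 v3 * w v1 v4 - w v1 v3 * w v2 v4 + w v1 v2 * w v3 v4.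
  by rewrite /pf /pfaff /radical !wD wN !wZ.
rewrite /radical /form_scal.
split; [| | | |split]; rewrite ?(wD, wN, wZ, wDr, wNr, wZr, w_alt);
  rewrite ?(alternatingC v2 v1) ?(alternatingC v3 v1) ?(alternatingC v3 v2);
  move: pfE => ->; ring.
Qed.

(** For [e] a Darboux frame of constant [c], this is [c] times the linear map taking each [e j] to
    [d j]. Not dividing by [c] keeps it polynomial in [e]. *)
Definition frame_map (e d : 'I_4 -> V) x : V :=
  w x (e 1) *: d 0 - w x (e 0) *: d 1 + w x (e 3) *: d 2 - w x (e 2) *: d 3.

Lemma frame_map_linear e d : linear (frame_map e d).
Proof.
move=> a x y; rewrite /frame_map !wD !wZ !scalerDl -!scalerA !scalerDr !scalerN.
rewrite !opprD (addrACA (a *: _) _ (- (a *: _))).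
by rewrite (addrACA (a *: _ - a *: _)) (addrACA (a *: _ - a *: _ + a *: _)).
Qed.

Lemma frame_mapZ e d a x : frame_map e d (a *: x) = a *: frame_map e d x.
Proof.
have := frame_map_linear e d a x 0; rewrite addr0 => ->.
by rewrite {2}/frame_map !w0 !scale0r !subr0 !addr0.
Qed.

Lemma frame_isometry (f : {linear V -> V}) v1 v2 v3 v4 j :
  (forall x y, w (f x) (f y) = w x y) ->
  frame (f v1) (f v2) (f v3) (f v4) j = f (frame v1 v2 v3 v4 j).
Proof.
move=> fw; have fZ a x : f (a *: x) = a *: f x by exact: linearZ.
have rf : radical (f v1) (f v2) (f v3) = f (radical v1 v2 v3).
  by rewrite /radical !fw linearD linearB !fZ.
have pf : pfaff (f v1) (f v2) (f v3) (f v4) = pfaff v1 v2 v3 v4.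
  by rewrite /pfaff rf fw.
rewrite /frame pf rf /form_scal !fw.
by case: (ord4 j) => -> /=; rewrite ?linearD ?linearN ?fZ.
Qed.

(** Isolates [v3]: the pairing with the radical becomes a linear form in [v3] given by a vector that
    depends only on [z], [v1], [v2], so its vanishing locus is a hyperplane as soon as that vector
    is nonzero. *)
Lemma radical_form z v1 v2 v3 : w z (radical v1 v2 v3) =
  w (w z v1 *: v2 - w z v2 *: v1 + w v1 v2 *: z) v3.
Proof. by rewrite /radical !wDr wNr !wZr !wD wN !wZ; ring. Qed.

Lemma frame_map_isometry (f : V -> V) e d x :
  (forall x y, w (f x) (f y) = w x y) ->
  frame_map (fun j => f (e j)) d (f x) = frame_map e d x.
Proof. by move=> fw; rewrite /frame_map !fw. Qed.

Let darboux_coord c e (a : 'I_4 -> K) : darboux c e ->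
  let x := \sum_i a i *: e i in
  [/\ w x (e 0) = - a 1 * c, w x (e 1) = a 0 * c,
      w x (e 2) = - a 3 * c & w x (e 3) = a 2 * c].
Proof.
move=> [e01 e23 e02 e03 [e12 e13]] x.
rewrite /x sum4 !wD !wZ !w_alt (alternatingC (e 1) (e 0)) (alternatingC (e 2)
  (e 0)).
rewrite (alternatingC (e 3) (e 0)) (alternatingC (e 2) (e 1)) (alternatingC (e
  3) (e 1)).
rewrite (alternatingC (e 3) (e 2)) e01 e23 e02 e03 e12 e13.
by rewrite !oppr0 !mulr0 !addr0 !add0r !mulrN !mulNr.
Qed.

(** Pairing with the frame recovers coordinates up to sign and the factor [c], so the four vectors
    are free, hence a basis. *)
Lemma darboux_span c e x : c != 0 -> darboux c e ->
  exists a : 'I_4 -> K, x = \sum_i a i *: e i.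
Proof.
move=> c0 de.
have fe : free [tuple e i | i < 4].
  apply/freeP => a; under eq_bigr do rewrite nth_mktuple.
  have [] := darboux_coord a de => + + + + h.
  rewrite h !w0 => /eqP; rewrite eq_sym mulf_eq0 oppr_eq0 (negbTE c0) orbF.
  move=> /eqP a1 /eqP; rewrite eq_sym mulf_eq0 (negbTE c0) orbF => /eqP a0.
  move=> /eqP; rewrite eq_sym mulf_eq0 oppr_eq0 (negbTE c0) orbF => /eqP a3.
  move=> /eqP; rewrite eq_sym mulf_eq0 (negbTE c0) orbF => /eqP a2.
  by move=> i; case: (ord4 i) => ->.
have be : basis_of fullv [tuple e i | i < 4].
  by rewrite basisEfree fe subvf size_tuple dimV.
exists (fun i => coord [tuple e i | i < 4] i x).
rewrite {1}(coord_basis be (memvf x)).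
by apply: eq_bigr => i _; rewrite nth_mktuple.
Qed.

Lemma frame_mapE c e d j : darboux c e -> frame_map e d (e j) = c *: d j.
Proof.
move=> [e01 e23 e02 e03 [e12 e13]]; rewrite /frame_map.
case: (ord4 j) => ->; rewrite ?w_alt ?(alternatingC (e 1) (e 0))
  ?(alternatingC (e 2) (e 0)) ?(alternatingC (e 3) (e 0))
  ?(alternatingC (e 2) (e 1)) ?(alternatingC (e 3) (e 1))
  ?(alternatingC (e 3) (e 2)) ?e01 ?e23 ?e02 ?e03 ?e12 ?e13.
all: by rewrite ?oppr0 ?scale0r ?scaleNr ?opprK ?oppr0 ?addr0 ?add0r ?subr0.
Qed.

(** In coordinates the form is [c] times the standard one on [e] and [c'] times it on [d]; the map
    is [c] times the change of frame, which gives [c ^ 2 c' / c]. *)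
Lemma frame_map_form c c' e d x y : c != 0 -> darboux c e -> darboux c' d ->
  w (frame_map e d x) (frame_map e d y) = c * c' * w x y.
Proof.
move=> c0 de dd; have [a ->] := darboux_span x c0 de.
pose L : {linear V -> V} :=
  HB.pack (frame_map e d) (GRing.isLinear.Build _ _ _ _ _ (frame_map_linear e
    d)).
have LE (b : 'I_4 -> K) : frame_map e d (\sum_i b i *: e i) =
    c *: \sum_i b i *: d i.
  rewrite -[frame_map e d]/(L : _ -> _) linear_sum scaler_sumr.
  apply: eq_bigr => i _; rewrite linearZ/= (frame_mapE _ _ de).
  by rewrite scalerA mulrC -scalerA.
have [b ->] := darboux_span y c0 de; rewrite !LE wZ wZr.
have sw (f : 'I_4 -> V) k : darboux k f ->
    w (\sum_i a i *: f i) (\sum_i b i *: f i) =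
    k * (a 0 * b 1 - a 1 * b 0 + a 2 * b 3 - a 3 * b 2).
  move=> df; rewrite [X in w _ X]sum4 !wDr !wZr.
  have [-> -> -> ->] := darboux_coord a df; ring.
by rewrite (sw d c')// (sw e c)// !mulrA [c * c * _]mulrAC.
Qed.

(* The frames of two triples in general position, completed arbitrarily, differ
   by a similitude of the form which carries the lines of one to the other. *)
Lemma triple_similitude v1 v2 v3 u1 u2 u3 :
  (forall x, (forall y, w x y = 0) -> x = 0) ->
  form_scal v1 v2 v3 != 0 -> radical v1 v2 v3 != 0 ->
  form_scal u1 u2 u3 != 0 -> radical u1 u2 u3 != 0 ->
  exists (f : V -> V) (c a1 a2 a3 : K), [/\ linear f,
    forall x y, w (f x) (f y) = c * w x y, c != 0,
    [/\ a1 != 0, a2 != 0 & a3 != 0] &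
    [/\ f v1 = a1 *: u1, f v2 = a2 *: u2 & f v3 = a3 *: u3]].
Proof.
move=> nd sv rv su ru.
have ex x : x != 0 -> exists y, w x y != 0.
  move=> /eqP x0; apply: contrapT => /forallNP h; apply: x0; apply: nd => y.
  by apply/eqP; move: (h y) => /negP; rewrite negbK.
have [v4 pv] := ex _ rv; have [u4 pu] := ex _ ru.
have cv : frame_scal v1 v2 v3 v4 != 0 by rewrite mulf_neq0// expf_neq0.
have cu : frame_scal u1 u2 u3 u4 != 0 by rewrite mulf_neq0// expf_neq0.
set e := frame v1 v2 v3 v4; set d := frame u1 u2 u3 u4.
have de := darboux_frame v1 v2 v3 v4; have dd := darboux_frame u1 u2 u3 u4.
have fE j := frame_mapE d j de.
move: (sv) (su); rewrite /form_scal !mulf_eq0 !negb_or -!andbA.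
move=> /and3P[v12 v13 v23] /and3P[u12 u13 u23].
set c := frame_scal v1 v2 v3 v4 in cv de fE.
set pv' := pfaff v1 v2 v3 v4; set pu' := pfaff u1 u2 u3 u4.
have pv0 : pv' != 0 by []. have pu0 : pu' != 0 by [].
have LD x y : frame_map e d (x + y) = frame_map e d x + frame_map e d y.
  by have := frame_map_linear e d 1 x y; rewrite !scale1r.
have LZ a x : frame_map e d (a *: x) = a *: frame_map e d x by exact:
  frame_mapZ.
have LN x : frame_map e d (- x) = - frame_map e d x by rewrite -scaleN1r LZ
  scaleN1r.
have LF x y : w (frame_map e d x) (frame_map e d y) =
    c * frame_scal u1 u2 u3 u4 * w x y by exact: frame_map_form.
move: fE LD LZ LN LF (frame_map_linear e d).
move: (frame_map e d) => L fE LD LZ LN LF Ll.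
have h1 : L v1 = (c * pu' * w u2 u3 / (pv' * w v2 v3)) *: u1.
  have := fE 0; rewrite {1}/d /frame /= -/pv' -/pu'.
  rewrite !LZ !scalerA => /(congr1 (GRing.scale (pv' * w v2 v3)^-1)).
  rewrite !scalerA mulVf ?mulf_neq0// scale1r => ->; rewrite -/pu'.
  by congr (_ *: _); ring.
have h2 : L v2 = (c * pu' * w u1 u3 / (pv' * w v1 v3)) *: u2.
  have := fE 1; rewrite {1}/d /frame /= -/pv' -/pu'.
  rewrite !LZ !scalerA => /(congr1 (GRing.scale (pv' * w v1 v3)^-1)).
  rewrite !scalerA mulVf ?mulf_neq0// scale1r => ->; rewrite -/pu'.
  by congr (_ *: _); ring.
(* The weights of [v1] and [v2] in the frame are their coefficients in the radical, so
   [e 2 - e 0 + e 1] is a multiple of [v3]: this is how the third line is carried along. *)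
have h3 : L v3 = (c * pu' * w u1 u2 / (pv' * w v1 v2)) *: u3.
  have := fE 2; rewrite {1}/d /frame /= -/pv' -/pu'.
  rewrite /radical LZ !LD LN !LZ h1 h2.
  move=> /(congr1 (GRing.scale pv'^-1)).
  rewrite !scalerA mulVf// scale1r !scalerDr !scalerN !scalerA.
  have -> : w v2 v3 * (c * pu' * w u2 u3 / (pv' * w v2 v3)) =
            pv'^-1 * (c * pu') * w u2 u3 by field; rewrite v23 pv0.
  have -> : w v1 v3 * (c * pu' * w u1 u3 / (pv' * w v1 v3)) =
            pv'^-1 * (c * pu') * w u1 u3 by field; rewrite v13 pv0.
  move=> /addrI /(congr1 (GRing.scale (w v1 v2)^-1)).
  rewrite !scalerA mulVf// scale1r => ->; congr (_ *: _).
  by field; rewrite v12 pv0.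
exists L, (c * frame_scal u1 u2 u3 u4), (c * pu' * w u2 u3 / (pv' * w v2 v3)),
  (c * pu' * w u1 u3 / (pv' * w v1 v3)), (c * pu' * w u1 u2 / (pv' * w v1 v2)).
split.
- exact: Ll.
- exact: LF.
- by rewrite mulf_neq0.
- by rewrite !mulf_neq0 ?invr_eq0 ?mulf_neq0.
- by [].
Qed.

End Frames.

(** * Similitudes, [Sp], and its action on lines *)

Section Symplectic.
Variables (R : realType) (omega : {biscalar C4 R}).
Hypothesis omega_alt : alternating_form omega.
Hypothesis omega_nondeg : nondegenerate_form omega.
Local Notation w := (omega : C4 R -> C4 R -> R[i]).

Lemma omegaD x y z : w (x + y) z = w x z + w y z. Proof. exact: linearDl. Qed.
Lemma omegaDr x y z : w x (y + z) = w x y + w x z. Proof. exact: linearDr. Qed.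
Lemma omegaZ a x y : w (a *: x) y = a * w x y. Proof. exact: linearZl_LR. Qed.
Lemma omegaZr a x y : w x (a *: y) = a * w x y. Proof. exact: linearZr_LR. Qed.

Lemma omega0 x : w 0 x = 0.
Proof. by have := omegaZ 0 0 x; rewrite scale0r mul0r. Qed.
Lemma omega0r x : w x 0 = 0.
Proof. by have := omegaZr 0 x 0; rewrite scale0r mul0r. Qed.

Lemma dim_C4 : \dim (fullv : {vspace C4 R}) = 4.
Proof. by rewrite dimvf /dim/=. Qed.

Lemma linear_matrix n (f : 'cV[R[i]]_n -> 'cV[R[i]]_n) : linear f ->
  exists M : 'M[R[i]]_n, forall x, f x = M *m x.
Proof.
move=> lf; pose h (u : 'rV[R[i]]_n) : 'rV[R[i]]_n := (f u^T)^T.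
have lh : linear h by move=> a u v; rewrite /h !linearP lf !linearP.
pose L : {linear 'rV[R[i]]_n -> 'rV[R[i]]_n} :=
  HB.pack h (GRing.isLinear.Build _ _ _ _ h lh).
exists (lin1_mx L)^T => x; apply: trmx_inj.
by rewrite trmx_mul trmxK mul_rV_lin1 /= /h trmxK.
Qed.

(** The complex multiplier [c] has a square root, and dividing by it gives an isometry. A vector
    killed by [f] is orthogonal to everything, hence zero, so the matrix is invertible. *)
Lemma similitude_Sp (f : C4 R -> C4 R) c : linear f -> c != 0 ->
  (forall x y, w (f x) (f y) = c * w x y) ->
  exists g k, [/\ Sp omega g, k != 0 & forall x, f x = k *: (g *m x)].
Proof.
move=> /linear_matrix[M fE] c0 fw.
have k0 : sqrtC c != 0 by rewrite sqrtC_eq0.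
have Mu : M \in unitmx.
  rewrite -unitmx_tr unitmxE unitfE; apply/negP => /det0P[v v0 vM].
  have Mv : M *m v^T = 0 by rewrite -[M]trmxK -trmx_mul vM trmx0.
  suff : v^T = 0 by move=> /(congr1 trmx); rewrite trmxK trmx0; apply/eqP.
  apply: omega_nondeg => y; apply: (mulfI c0).
  by rewrite -(fw v^T y) fE Mv mulr0 omega0.
exists ((sqrtC c)^-1 *: M), (sqrtC c); split=> //; last first.
  by move=> x; rewrite fE -scalemxAl scalerA mulfV// scale1r.
split; first by rewrite unitmxZ// unitfE invr_eq0.
move=> u v; rewrite -!scalemxAl -!fE (omegaZ _ (f u)) (omegaZr _ (f u)) fw.
by rewrite mulrA -expr2 exprVn sqrtCK mulKf.
Qed.

Lemma Sp_unit g : Sp omega g -> g \in unitmx. Proof. by case. Qed.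

Lemma mulmx_unit_neq0 (g : 'M[R[i]]_4) (v : C4 R) :
  g \in unitmx -> v != 0 -> g *m v != 0.
Proof.
move=> gu; apply: contraNN => /eqP/(congr1 (mulmx (invmx g))).
by rewrite mulKmx// mulmx0 => ->.
Qed.

Lemma act_proj g (v : C4 R) : g \in unitmx -> v != 0 -> act g (proj v) = proj
  (g *m v).
Proof.
move=> gu v0; have gv0 := mulmx_unit_neq0 gu v0.
apply: val_inj; rewrite /= projE// /Defs.act.
have e : (linfun (mulmx g : C4 R -> C4 R) @: line (proj v))%VS = <[g *m v]>%VS.
  by rewrite projE// limg_line lfunE.
by rewrite insubdK e// unfold_in dim_vline gv0.
Qed.

Lemma proj_surj (x : projective R) : exists2 v, v != 0 & x = proj v.
Proof.
have lx : line x != 0%VS by rewrite -dimv_eq0 (eqP (line_dim x)).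
exists (vpick (line x)); first by rewrite vpick0.
apply: val_inj; rewrite /= projE ?vpick0//; apply/esym/eqP.
rewrite eqEdim -memvE memv_pick (eqP (line_dim x)) dim_vline.
by rewrite vpick0 lx.
Qed.

Lemma proj_inj_line (u v : C4 R) : u != 0 -> v != 0 -> proj u = proj v ->
  exists2 k, k != 0 & u = k *: v.
Proof.
move=> u0 v0 /(congr1 (@line R)); rewrite !projE// => e.
have : u \in <[v]>%VS by rewrite -e memv_line.
move=> /vlineP[k uE]; exists k => //; apply: contraNneq u0 => k0.
by rewrite uE k0 scale0r.
Qed.

Definition rep (x : projective R) : C4 R := vpick (line x).

Lemma rep_neq0 x : rep x != 0.
Proof. by rewrite vpick0 -dimv_eq0 (eqP (line_dim x)). Qed.

Lemma repK x : proj (rep x) = x.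
Proof.
have [v v0 ->] := proj_surj x; apply: val_inj; rewrite /= projE ?rep_neq0//.
apply/eqP; rewrite eqEdim !dim_vline rep_neq0 -memvE memv_pick.
by rewrite (eqP (line_dim _)).
Qed.

Local Notation scal3 := (form_scal w).
Local Notation rad3 := (radical w).

Lemma triple_transitive v1 v2 v3 u1 u2 u3 :
  scal3 v1 v2 v3 != 0 -> rad3 v1 v2 v3 != 0 ->
  scal3 u1 u2 u3 != 0 -> rad3 u1 u2 u3 != 0 ->
  exists2 g, Sp omega g & [/\ act g (proj v1) = proj u1,
    act g (proj v2) = proj u2 & act g (proj v3) = proj u3].
Proof.
move=> sv rv su ru.
have := triple_similitude dim_C4 omegaD omegaDr omegaZ omega_alt omega_nondeg
  sv rv su ru.
move=> [f [c [a1 [a2 [a3 [lf fw c0 [a10 a20 a30] [f1 f2 f3]]]]]]].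
have [g [k [gS k0 gE]]] := similitude_Sp lf c0 fw.
have nz x y : w x y != 0 -> x != 0 /\ y != 0.
  move=> xy; split; apply: contra xy => /eqP ->.
    by rewrite omega0.
  by rewrite omega0r.
move: sv; rewrite /form_scal !mulf_eq0 !negb_or -andbA => /and3P[].
move=> /nz[v10 v20] /nz[_ v30] _.
exists g => //; have gu := Sp_unit gS.
have aE v u a : v != 0 -> a != 0 -> f v = a *: u -> act g (proj v) = proj u.
  move=> v0 a0; rewrite gE act_proj// => e.
  by rewrite -(projZ _ k0) e projZ.
by split; [exact: aE f1|exact: aE f2|exact: aE f3].
Qed.

End Symplectic.

Lemma cV_sum_delta (A : pzRingType) n (v : 'cV[A]_n) :
  v = \sum_i v i 0 *: delta_mx i 0.
Proof.
by rewrite {1}[v]matrix_sum_delta; apply: eq_bigr => i _; rewrite big_ord1.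
Qed.

(** * Measurability of complex and vector-valued maps *)

Section ComplexMeasurable.
Context d (S : measurableType d) (R : realType).
Implicit Types f g : S -> R[i].

Definition cmeasurable f := measurable_fun setT (fun s => complex.Re (f s)) /\
  measurable_fun setT (fun s => complex.Im (f s)).

Lemma cmeasurable_cst (z : R[i]) : cmeasurable (fun=> z).
Proof. by split; exact: measurable_cst. Qed.

Lemma cmeasurableD f g : cmeasurable f -> cmeasurable g ->
  cmeasurable (fun s => f s + g s).
Proof.
move=> [f1 f2] [g1 g2]; split.
  rewrite (_ : (fun s => _) = fun s => complex.Re (f s) + complex.Re (g s)).
    exact: measurable_funD.
  by apply/funext => s; rewrite raddfD.
rewrite (_ : (fun s => _) = fun s => complex.Im (f s) + complex.Im (g s)).
  exact: measurable_funD.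
by apply/funext => s; rewrite raddfD.
Qed.

Lemma cmeasurableM f g : cmeasurable f -> cmeasurable g ->
  cmeasurable (fun s => f s * g s).
Proof.
move=> [f1 f2] [g1 g2]; split.
  rewrite (_ : (fun s => _) = fun s => complex.Re (f s) * complex.Re (g s)
      - complex.Im (f s) * complex.Im (g s)).
    by apply: measurable_funB;
      exact: measurable_funM.
  by apply/funext => s; case: (f s) (g s) => a b [a' b'].
rewrite (_ : (fun s => _) = fun s => complex.Re (f s) * complex.Im (g s)
      + complex.Im (f s) * complex.Re (g s)).
  by apply: measurable_funD;
    exact: measurable_funM.
by apply/funext => s; case: (f s) (g s) => a b [a' b'].
Qed.

Lemma cmeasurableN f : cmeasurable f -> cmeasurable (fun s => - f s).
Proof.
move=> mf; rewrite (_ : (fun s => _) = fun s => -1 * f s).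
  exact: cmeasurableM (cmeasurable_cst _) mf.
by apply/funext => s; rewrite mulN1r.
Qed.

Lemma cmeasurable_sum (I : Type) (r : seq I) (F : I -> S -> R[i]) :
  (forall i, cmeasurable (F i)) -> cmeasurable (fun s => \sum_(i <- r) F i s).
Proof.
move=> mF; elim: r => [|i r IH].
  under eq_fun do rewrite big_nil; exact: cmeasurable_cst.
by under eq_fun do rewrite big_cons; exact: cmeasurableD.
Qed.

Lemma measurable_cneq0 f : cmeasurable f -> measurable [set s | f s != 0].
Proof.
move=> [f1 f2].
rewrite (_ : mkset _ = ~` (((fun s => complex.Re (f s)) @^-1` [set 0]) `&`
                          ((fun s => complex.Im (f s)) @^-1` [set 0]))).
  apply: measurableC; apply: measurableI; rewrite -[X in measurable X]setTI.
    exact: f1.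
  exact: f2.
apply/seteqP; split => s /=; rewrite eq_complex negb_and /=.
  by move=> /orP[/eqP h [h1 _]|/eqP h [_ h1]].
by move=> h; rewrite -negb_and; apply/negP => /andP[/eqP ? /eqP ?]; apply: h.
Qed.

Definition vmeasurable n (f : S -> 'cV[R[i]]_n) :=
  forall k, cmeasurable (fun s => f s k 0).

Lemma vmeasurable_cst n (v : 'cV[R[i]]_n) : vmeasurable (fun=> v).
Proof. by move=> k; exact: cmeasurable_cst. Qed.

Lemma vmeasurableD n (f g : S -> 'cV[R[i]]_n) : vmeasurable f -> vmeasurable g
  ->
  vmeasurable (fun s => f s + g s).
Proof.
move=> mf mg k; under eq_fun do rewrite mxE; exact: cmeasurableD.
Qed.

Lemma vmeasurableZ n a (f : S -> 'cV[R[i]]_n) : cmeasurable a -> vmeasurable f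
  ->
  vmeasurable (fun s => a s *: f s).
Proof.
move=> mf mg k; under eq_fun do rewrite mxE; exact: cmeasurableM.
Qed.

Lemma vmeasurableN n (f : S -> 'cV[R[i]]_n) : vmeasurable f ->
  vmeasurable (fun s => - f s).
Proof. by move=> mf k; under eq_fun do rewrite mxE; exact: cmeasurableN. Qed.

Lemma vmeasurableB n (f g : S -> 'cV[R[i]]_n) : vmeasurable f -> vmeasurable g
  ->
  vmeasurable (fun s => f s - g s).
Proof. by move=> mf mg; apply: vmeasurableD => //; exact: vmeasurableN. Qed.

Lemma measurable_tuple_of_cvec n (f : S -> 'cV[R[i]]_n) : vmeasurable f ->
  measurable_fun setT (fun s => tuple_of_cvec (f s)).
Proof.
move=> mf; apply/measurable_fun_tnthP => i.
rewrite (_ : _ \o _ = fun s => match fintype.split i with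
   | inl j => complex.Re (f s j 0) | inr j => complex.Im (f s j 0) end).
  by case: (fintype.split i) => j; case: (mf j).
by apply/funext => s; rewrite /= tnth_mktuple.
Qed.

Lemma vmeasurable_cvec n (f : S -> (n + n).-tuple (measurableTypeR R)) :
  measurable_fun setT f -> vmeasurable (fun s => cvec (f s)).
Proof.
move=> /measurable_fun_tnthP mf k; split.
  by under eq_fun do rewrite mxE /=; exact: mf.
by under eq_fun do rewrite mxE /=; exact: mf.
Qed.

Lemma measurable_proj_of (f : S -> C4 R) : vmeasurable f ->
  measurable_fun setT (fun s => proj (f s)).
Proof.
move=> mf; rewrite (_ : (fun s => _) =
    (fun y => proj (@cvec R 4 y)) \o (fun s => tuple_of_cvec (f s))).
  apply: measurableT_comp; first exact: measurable_proj.
  exact: measurable_tuple_of_cvec.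
by apply/funext => s /=; rewrite tuple_of_cvecK.
Qed.

Variable omega : {biscalar C4 R}.

Lemma cmeasurable_form (f g : S -> C4 R) : vmeasurable f -> vmeasurable g ->
  cmeasurable (fun s => omega (f s) (g s)).
Proof.
move=> mf mg.
rewrite (_ : (fun s => _) = fun s => \sum_i \sum_j f s i 0 * (g s j 0 *
    omega (delta_mx i 0) (delta_mx j 0))).
  apply: cmeasurable_sum => i; apply: cmeasurable_sum => j.
  by do 2?[apply: cmeasurableM => //]; exact: cmeasurable_cst.
apply/funext => s; rewrite {1}(cV_sum_delta (f s)) linear_sumlz.
apply: eq_bigr => i _; rewrite {1}(cV_sum_delta (g s)) linear_sumr.
apply: eq_bigr => j _; rewrite linearZl_LR linearZr_LR/=.
by rewrite /GRing.scale/= mulrCA mulrA mulrAC -mulrA mulrCA.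
Qed.

End ComplexMeasurable.

Lemma measurable_cons_section d (T : measurableType d) n a
    (P : set (n.+1.-tuple T)) :
  measurable P -> measurable [set t | P (cons_tuple a t)].
Proof.
move=> mP; rewrite -[X in measurable X]setTI.
exact: (measurable_cons (measurable_cst a) (@measurable_id _ _ setT)).
Qed.

Lemma ae_cons_tuple d (T : measurableType d) (R : realType)
    (mu : {sigma_finite_measure set T -> \bar R}) n (P : set (n.+1.-tuple T)) :
  measurable P ->
  (\forall a \ae mu, \forall t \ae tuple_measure mu n, P (cons_tuple a t)) ->
  \forall x \ae tuple_measure mu n.+1, P x.
Proof.
move=> mP h; exists (~` P); split => //; first exact: measurableC.
apply: tuple_measure_null; first exact: measurableC.
by apply: ae_imp h => a; apply: ae_imp => t /=; rewrite /setC /= => h [].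
Qed.

(** * The maps [K_p]: equivariance, measurability, genericity *)

Section FrameKernel.
Variables (R : realType) (omega : {biscalar C4 R}).
Hypothesis omega_alt : alternating_form omega.
Hypothesis omega_nondeg : nondegenerate_form omega.
Local Notation w := (omega : C4 R -> C4 R -> R[i]).
Local Notation tR n := (n.-tuple (measurableTypeR R)).
Local Notation V4 := (tR (4 + 4)).
Variable nu : {sigma_finite_measure set V4 -> \bar R}.
Hypothesis ae_row : forall r : 'rV[R[i]]_4, r != 0 ->
  \forall y \ae nu, r *m cvec y != 0.

Definition vecs n (p : n.-tuple V4) (i : 'I_n) : C4 R := @cvec R 4 (tnth p i).

Definition pframe (p : 4.-tuple V4) : 'I_4 -> C4 R :=
  frame w (vecs p 0) (vecs p 1) (vecs p 2) (vecs p 3).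

Definition pscal (p : 4.-tuple V4) : R[i] :=
  frame_scal w (vecs p 0) (vecs p 1) (vecs p 2) (vecs p 3).

(** A linear lift of [K_p]: up to a scalar it carries the frame of [p] to a reference frame [d],
    which stays fixed. *)
Definition kvec (d : 'I_4 -> C4 R) p x := frame_map w (pframe p) d x.

Definition kact d p (x : projective R) : projective R := proj (kvec d p (rep
  x)).

Definition gmap (g : 'M[R[i]]_4) (y : V4) : V4 := tuple_of_cvec (g *m cvec y).

Lemma kvecZ d p a x : kvec d p (a *: x) = a *: kvec d p x.
Proof.
exact: (frame_mapZ (@omegaD R omega) (@omegaZ R omega)).
Qed.

Lemma kact_proj d p v : v != 0 -> kact d p (proj v) = proj (kvec d p v).
Proof.
move=> v0; have [k k0 e] := proj_inj_line (rep_neq0 (proj v)) v0 (repK _).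
by rewrite /kact e kvecZ projZ.
Qed.

Lemma vecs_gmap n g (p : n.-tuple V4) i :
  vecs [tuple of map (gmap g) p] i = g *m vecs p i.
Proof. by rewrite /vecs tnth_map /gmap tuple_of_cvecK. Qed.

Lemma frame_Sp g v1 v2 v3 v4 j : Sp omega g ->
  frame w (g *m v1) (g *m v2) (g *m v3) (g *m v4) j = g *m frame w v1 v2 v3 v4
    j.
Proof.
move=> [_ gw]; exact: (@frame_isometry _ _ w (mulmx g)).
Qed.

(** Isometries commute with the formation of frames and preserve the pairings with them, and these
    pairings are all that [kvec] uses of [p] and [x]. *)
Lemma kvec_Sp d g (p : 4.-tuple V4) x : Sp omega g ->
  kvec d [tuple of map (gmap g) p] (g *m x) = kvec d p x.
Proof.
move=> gS; rewrite /kvec.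
have -> : pframe [tuple of map (gmap g) p] = fun j => g *m pframe p j.
  by apply/funext => j; rewrite /pframe !vecs_gmap; exact: frame_Sp.
apply: frame_map_isometry; exact: gS.2.
Qed.

Lemma kact_Sp d g (p : 4.-tuple V4) x : Sp omega g ->
  kact d [tuple of map (gmap g) p] (act g x) = kact d p x.
Proof.
move=> gS; have [v v0 ->] := proj_surj x; have gu := gS.1.
have gv0 := mulmx_unit_neq0 gu v0.
by rewrite (act_proj gu v0) (kact_proj _ _ gv0) (kact_proj _ _ v0) kvec_Sp.
Qed.

(** When [pscal p != 0] the frame of [p] is a basis and [kvec] is a similitude with multiplier
    [pscal p * c]. The element [g] is obtained for each [p] separately. *)
Lemma kact_in_Sp d c p : c != 0 -> darboux w c d -> pscal p != 0 ->
  exists2 g, Sp omega g & forall x, kact d p x = act g x.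
Proof.
move=> c0 dd p0.
have dp : darboux w (pscal p) (pframe p).
  exact: (darboux_frame (@omegaD R omega) (@omegaDr R omega) (@omegaZ R omega)
    omega_alt).
have [|||g [k [gS k0 gE]]] :=
    @similitude_Sp R omega omega_nondeg (kvec d p) (pscal p * c).
- exact: (frame_map_linear (@omegaD R omega) (@omegaZ R omega)).
- by rewrite mulf_neq0.
- move=> x y; exact: (frame_map_form (dim_C4 R) (@omegaD R omega)
    (@omegaDr R omega) (@omegaZ R omega) omega_alt).
exists g => // x; have [v v0 ->] := proj_surj x.
by rewrite kact_proj// act_proj ?gS.1// gE projZ.
Qed.

Lemma cmeasurable_frame_scal d (S : measurableType d)
    (v1 v2 v3 v4 : S -> C4 R) :
  vmeasurable v1 -> vmeasurable v2 -> vmeasurable v3 -> vmeasurable v4 ->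
  cmeasurable (fun s => frame_scal w (v1 s) (v2 s) (v3 s) (v4 s)).
Proof.
move=> m1 m2 m3 m4.
have mw := @cmeasurable_form _ S R omega.
have mr : vmeasurable (fun s => radical w (v1 s) (v2 s) (v3 s)).
  by apply: vmeasurableD; [apply: vmeasurableB|]; apply: vmeasurableZ => //;
    exact: mw.
have mp : cmeasurable (fun s => pfaff w (v1 s) (v2 s) (v3 s) (v4 s)) by exact:
  mw.
apply: cmeasurableM; last exact: cmeasurableM.
by apply: cmeasurableM; [apply: cmeasurableM|]; exact: mw.
Qed.

Lemma vmeasurable_frame d (S : measurableType d) (v1 v2 v3 v4 : S -> C4 R) j :
  vmeasurable v1 -> vmeasurable v2 -> vmeasurable v3 -> vmeasurable v4 ->
  vmeasurable (fun s => frame w (v1 s) (v2 s) (v3 s) (v4 s) j).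
Proof.
move=> m1 m2 m3 m4.
have mw := @cmeasurable_form _ S R omega.
have mr : vmeasurable (fun s => radical w (v1 s) (v2 s) (v3 s)).
  by apply: vmeasurableD; [apply: vmeasurableB|]; apply: vmeasurableZ => //;
    exact: mw.
have mp : cmeasurable (fun s => pfaff w (v1 s) (v2 s) (v3 s) (v4 s)) by exact:
  mw.
have ms : cmeasurable (fun s => form_scal w (v1 s) (v2 s) (v3 s)).
  by apply: cmeasurableM; [apply: cmeasurableM|]; exact: mw.
case: (ord4 j) => ->; rewrite /frame /=.
- by apply: vmeasurableZ => //; apply: vmeasurableZ => //; exact: mw.
- by apply: vmeasurableZ => //; apply: vmeasurableZ => //; exact: mw.
- exact: vmeasurableZ.
apply: vmeasurableD; [apply: vmeasurableB; first exact: vmeasurableZ|];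
  apply: vmeasurableZ => //; apply: cmeasurableM; try exact: mw;
  by apply: cmeasurableM; exact: mw.
Qed.

Lemma vmeasurable_vecs d (S : measurableType d) n (p : S -> n.-tuple V4) i :
  measurable_fun setT p -> vmeasurable (fun s => vecs (p s) i).
Proof. by move=> /measurable_fun_tnthP mp; apply: vmeasurable_cvec; exact: mp.
  Qed.

Lemma vmeasurable_kvec e d (S : measurableType d) (p : S -> 4.-tuple V4)
    (x : S -> C4 R) : measurable_fun setT p -> vmeasurable x ->
  vmeasurable (fun s => kvec e (p s) (x s)).
Proof.
move=> mp mx.
have mf j : vmeasurable (fun s => pframe (p s) j).
  by apply: vmeasurable_frame; exact: vmeasurable_vecs.
have mt j k : vmeasurable (fun s => w (x s) (pframe (p s) j) *: e k).
  apply: vmeasurableZ; last exact: vmeasurable_cst.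
  exact: (cmeasurable_form omega mx (mf j)).
apply: vmeasurableB => //; apply: vmeasurableD => //; exact: vmeasurableB.
Qed.

Lemma measurable_pscal : measurable [set p | pscal p != 0].
Proof.
apply: measurable_cneq0.
by apply: cmeasurable_frame_scal; exact: vmeasurable_vecs.
Qed.

Lemma ae_omega_neq0 v : v != 0 -> \forall y \ae nu, w v (@cvec R 4 y) != 0.
Proof.
move=> v0; pose r : 'rV[R[i]]_4 := \row_j w v (delta_mx j 0).
have rE (y : C4 R) : r *m y = (w v y)%:M.
  apply/matrixP => i j; rewrite !ord1 !mxE [in RHS](cV_sum_delta y) linear_sumr.
  by apply: eq_bigr => k _; rewrite !mxE linearZr_LR/= mulrC.
have r0 : r != 0.
  apply: contra v0 => /eqP r0; apply/eqP/omega_nondeg => y.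
  by have := rE y; rewrite r0 mul0mx => /matrixP/(_ 0 0); rewrite !mxE.
have := ae_row r0; apply: ae_imp => y.
by rewrite rE; apply: contraNN => /eqP ->; rewrite -scalemx1 scale0r.
Qed.

Lemma ae_neq0 : \forall y \ae nu, @cvec R 4 y != 0.
Proof.
have r0 : (delta_mx 0 0 : 'rV[R[i]]_4) != 0.
  by apply/eqP => /matrixP/(_ 0 0)/eqP; rewrite !mxE eqxx oner_eq0.
have := ae_row r0; apply: ae_imp => y.
by apply: contraNN => /eqP ->; rewrite mulmx0.
Qed.

(** For the radical, take [z] outside the span of [v1] and [v2]. The vector [u] of [radical_form] is
    then nonzero, so almost every [v3] pairs nontrivially with it, which excludes a zero radical. *)
Lemma ae_triple : \forall y1 \ae nu, \forall y2 \ae nu, \forall y3 \ae nu,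
  form_scal w (@cvec R 4 y1) (cvec y2) (cvec y3) != 0 /\
  radical w (@cvec R 4 y1) (cvec y2) (cvec y3) != 0.
Proof.
apply: ae_imp ae_neq0 => y1 v10.
apply: ae_imp (ae_omega_neq0 v10) => y2; set v1 := cvec y1;
  set v2 : C4 R := cvec y2.
move=> v12; have v20 : v2 != 0 by apply: contraNneq v12 => ->;
  rewrite (omega0r omega).
have [z zn] : exists z, z \notin <<[:: v1; v2]>>%VS.
  apply: contrapT => /forallNP h.
  have : (fullv <= <<[:: v1; v2]>>)%VS.
    by apply/subvP => z _; move: (h z) => /negP; rewrite negbK.
  by move=> /dimvS; rewrite dim_C4 => /leq_trans/(_ (dim_span _)).
pose u := w z v1 *: v2 - w z v2 *: v1 + w v1 v2 *: z.
have u0 : u != 0.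
  apply: contraNneq zn => uz.
  have -> : z = (w v1 v2)^-1 *: (w z v2 *: v1 - w z v1 *: v2).
    apply: (scalerI v12); rewrite scalerA mulfV// scale1r.
    by apply/eqP; rewrite -subr_eq0 opprB addrC -/u uz.
  by rewrite memvZ// memvB// memvZ// memv_span// !inE eqxx ?orbT.
apply: filterS3 (ae_omega_neq0 v10) (ae_omega_neq0 v20) (ae_omega_neq0 u0).
move=> y3; set v3 : C4 R := cvec y3 => v13 v23 uv3; split.
  by rewrite !mulf_neq0.
apply: contraNneq uv3 => r0.
have := radical_form (@omegaD R omega) (@omegaDr R omega) (@omegaZ R omega)
  omega_alt z v1 v2 v3.
by rewrite r0 (omega0r omega) => <-.
Qed.

Lemma ae_pfaff v1 v2 v3 : radical w v1 v2 v3 != 0 ->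
  \forall y \ae nu, pfaff w v1 v2 v3 (@cvec R 4 y) != 0.
Proof. exact: ae_omega_neq0. Qed.

Lemma ae_pscal : \forall p \ae tuple_measure nu 4, pscal p != 0.
Proof.
have h (y1 y2 y3 y4 : V4) t :
    form_scal w (@cvec R 4 y1) (cvec y2) (cvec y3) != 0 ->
    pfaff w (@cvec R 4 y1) (cvec y2) (cvec y3) (cvec y4) != 0 ->
    pscal (cons_tuple y1 (cons_tuple y2 (cons_tuple y3 (cons_tuple y4 t)))) !=
      0.
  by move=> s0 p0; rewrite mulf_neq0// expf_neq0.
apply: (@ae_cons_tuple _ _ _ nu 3 _ measurable_pscal).
apply: ae_imp ae_triple => y1 h1.
have m1 := measurable_cons_section y1 measurable_pscal.
apply: (@ae_cons_tuple _ _ _ nu 2 _ m1).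
apply: ae_imp h1 => y2 h2; have m2 := measurable_cons_section y2 m1.
apply: (@ae_cons_tuple _ _ _ nu 1 _ m2).
apply: ae_imp h2 => y3 [s0 /ae_pfaff h3].
have m3 := measurable_cons_section y3 m2.
apply: (@ae_cons_tuple _ _ _ nu 0 _ m3).
by apply: ae_imp h3 => y4 p0; apply: nearW => t; exact: h.
Qed.

End FrameKernel.

(** * Alternation and chains *)

(** Permutations are sorted by the image [j] of [i]; what is left is a permutation of the other [n]
    points. *)
Lemma sum_lift_perm (V : nmodType) n (i : 'I_n.+1) (F : 'S_n.+1 -> V) :
  \sum_s F s = \sum_j \sum_(t : 'S_n) F (lift_perm i j t).
Proof.
pose h (q : 'I_n.+1 * 'S_n) := lift_perm i q.1 q.2.
rewrite pair_big (reindex h)//=; apply: onW_bij; apply: inj_card_bij.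
  move=> [j t] [j' t'] e; have ej : j = j'.
    by have := congr1 (fun s : 'S_n.+1 => s i) e; rewrite /h !lift_perm_id.
  rewrite -ej in e *; congr (_, _); apply/permP => k; apply: (@lift_inj _ j).
  by rewrite -!(lift_perm_lift i) -/(h (j, t)) e.
by rewrite card_prod card_ord !card_Sn factS.
Qed.

Section Alternation.
Variables (T : Type) (K : fieldType).

Definition alternate n (h : n.-tuple T -> K) (x : n.-tuple T) : K :=
  n`!%:R^-1 * \sum_(s : 'S_n) (-1) ^+ s * h (permt s x).

Lemma permtM n (s t : 'S_n) (x : n.-tuple T) :
  permt t (permt s x) = permt (t * s)%g x.
Proof. by apply: eq_from_tnth => j; rewrite !tnth_mktuple permM. Qed.

Lemma alternate_permt n h (s : 'S_n) x :
  alternate h (permt s x) = (-1) ^+ s * alternate h x.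
Proof.
rewrite /alternate mulrCA; congr (_ * _); rewrite mulr_sumr.
rewrite [RHS](reindex_inj (mulIg s)); apply: eq_bigr => t _.
by rewrite permtM odd_permM signr_addb [_ * (-1) ^+ s]mulrC mulrA signrMK.
Qed.

Lemma face_permt n (i j : 'I_n.+1) (t : 'S_n) (x : n.+1.-tuple T) :
  face i (permt (lift_perm i j t) x) = permt t (face j x).
Proof.
by apply: eq_from_tnth => k; rewrite !tnth_mktuple lift_perm_lift.
Qed.

(** Alternation is a cochain map. Summed over all permutations, each of the [n + 1] faces
    contributes the same amount, because [lift_perm i j t] has sign [(-1)^(i + j) sgn t]; the factor
    [n + 1] turns [1 / (n + 1)!] into [1 / n!]. *)
Lemma alternate_coboundary n (h : n.-tuple T -> K) x : n.+1%:R != 0 :> K ->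
  alternate (coboundary h) x = coboundary (alternate h) x.
Proof.
move=> n0; rewrite /alternate /coboundary.
have e (i : 'I_n.+1) : \sum_(s : 'S_n.+1) (-1) ^+ s * ((-1) ^+ i * h (face i
  (permt s x))) =
    \sum_(j < n.+1) (-1) ^+ j * \sum_(t : 'S_n) (-1) ^+ t * h (permt t (face j
      x)).
  rewrite (sum_lift_perm i); apply: eq_bigr => j _; rewrite mulr_sumr.
  apply: eq_bigr => t _; rewrite face_permt odd_lift_perm !signr_addb
    !signr_odd.
  by rewrite !mulrA; congr (_ * _); rewrite mulrAC [_ * (-1) ^+ i]mulrC mulrA
    signrMK.
under eq_bigr do rewrite mulr_sumr.
rewrite exchange_big /=; under eq_bigr do rewrite e.
rewrite sumr_const card_ord -[X in _ * X]mulr_natl mulrA factS natrM invfM [X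
  in X * _]mulrAC.
rewrite mulVf// mul1r mulr_sumr; apply: eq_bigr => j _.
by rewrite mulrCA.
Qed.

End Alternation.

Section Chains.
Variables (R : realType) (omega : {biscalar C4 R}).
Notation X := (projective R).

Lemma Omega_reindex m n (f : 'I_m -> 'I_n) (x : n.-tuple X) : injective f ->
  Omega omega x -> Omega omega [tuple tnth x (f j) | j < m].
Proof.
move=> injf [xw xs]; split => [i j v w ij|S cS].
  by rewrite !tnth_mktuple; apply: xw; rewrite (inj_eq injf).
rewrite -(xs (f @: S)) ?card_imset// big_imset /=; last by move=> i j _ _ /injf.
by apply: eq_bigr => i _; rewrite tnth_mktuple.
Qed.

Lemma Omega_face n i (x : n.+1.-tuple X) : Omega omega x -> Omega omega (face i
  x).
Proof. exact/Omega_reindex/lift_inj. Qed.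

Lemma Omega_permt n (s : 'S_n) (x : n.-tuple X) :
  Omega omega x -> Omega omega (permt s x).
Proof. exact/Omega_reindex/perm_inj. Qed.

Lemma actt_reindex m n (f : 'I_m -> 'I_n) g (x : n.-tuple X) :
  actt g [tuple tnth x (f j) | j < m] = [tuple tnth (actt g x) (f j) | j < m].
Proof. by apply: eq_from_tnth => j; rewrite tnth_map !tnth_mktuple tnth_map.
  Qed.

Lemma actt_face n i g (x : n.+1.-tuple X) : actt g (face i x) = face i (actt g
  x).
Proof. exact: actt_reindex. Qed.

Lemma actt_permt n (s : 'S_n) g (x : n.-tuple X) :
  actt g (permt s x) = permt s (actt g x).
Proof. exact: actt_reindex. Qed.

(** The pairing sees only coefficients, which are what [orbit_eq] compares. The support [s] is left
    free so that several chains can be summed over a common one. *)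
Lemma pairingE n (c : n.-tuple X -> R) (Z : fsum R n) (s : seq (n.-tuple X)) :
  uniq s -> {subset map snd Z <= s} ->
  pairing c Z = \sum_(x <- s) coef Z x * c x.
Proof.
move=> us Zs; rewrite /pairing.
transitivity (\sum_(p <- Z) \sum_(x <- s | p.2 == x) p.1 * c x).
  rewrite big_seq [RHS]big_seq; apply: eq_bigr => p pZ.
  rewrite (eq_bigl (pred1 p.2)); last by move=> x; rewrite /= eq_sym.
  by rewrite -big_filter filter_pred1_uniq// ?big_seq1// Zs// map_f.
rewrite (exchange_big_dep xpredT)//=; apply: eq_bigr => x _.
by rewrite /coef mulr_suml.
Qed.

Lemma pairing_orbit_eq n (c : n.-tuple X -> R) (Z Z' : fsum R n) :
  invariant_on omega (Omega omega) c -> alternating_on (Omega omega) c ->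
  orbit_eq omega Z Z' -> pairing c Z = pairing c Z'.
Proof.
move=> cinv calt [rs rsP e].
pose s := undup (map snd Z ++ map snd Z' ++ flatten [seq map snd r.2 | r <-
  rs]).
have us : uniq s by exact: undup_uniq.
apply/eqP; rewrite -subr_eq0; apply/eqP.
rewrite (pairingE c us) ?(pairingE c us); first last.
- by move=> x xZ; rewrite mem_undup mem_cat xZ.
- by move=> x xZ; rewrite mem_undup !mem_cat xZ orbT.
rewrite -sumrB; under eq_bigr do rewrite -mulrBl e mulr_suml.
rewrite exchange_big big_seq big1// => r rrs.
under eq_bigr do rewrite -mulrA.
rewrite -mulr_sumr -(pairingE c us); last first.
  move=> x xr; rewrite mem_undup !mem_cat; apply/orP; right; apply/orP; right.
  by apply/flattenP; exists (map snd r.2) => //; apply/mapP; exists r.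
suff -> : pairing c r.2 = 0 by rewrite mulr0.
have [[t [x [xO ->]]]|[g [x [gS xO ->]]]] := rsP r rrs;
  rewrite /pairing !big_cons big_nil /=.
  by rewrite addr0 mul1r calt// mulNr subrr.
by rewrite addr0 mul1r cinv// mulN1r subrr.
Qed.

Lemma pairing_boundary n (c : n.-tuple X -> R) (Z : fsum R n.+1) :
  pairing c (boundary Z) = pairing (coboundary c) Z.
Proof.
rewrite /pairing /boundary big_allpairs_dep /=; apply: eq_bigr => p _.
rewrite /coboundary big_enum /= mulr_sumr; apply: eq_bigr => i _.
by rewrite [RHS]mulrCA mulrA.
Qed.

(** On generic tuples [C] is its own alternation, so [C] is [alternate E] plus the coboundary of
    [alternate phi]. The second term pairs to zero with cycles; the first is invariant and
    alternating, so it may be evaluated on any representative [Z'], and it is still bounded by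
    [B]. *)
Lemma pairing_cycle_le n (C : n.+1.-tuple X -> R) (phi : n.-tuple X -> R) (B :
  R)
    (Z : fsum R n.+1) :
  invariant_on omega (Omega omega) C -> alternating_on (Omega omega) C ->
  invariant_on omega (Omega omega) phi ->
  (forall x, Omega omega x -> `|C x - coboundary phi x| <= B) -> 0 <= B ->
  orbit_cycle omega Z -> `|pairing C Z| <= B * mass omega Z.
Proof.
move=> Cinv Calt phiinv le_B B0 [gZ cZ].
pose E x := C x - coboundary phi x.
have Einv : invariant_on omega (Omega omega) (alternate E).
  move=> g x gS xO; rewrite /alternate; congr (_ * _); apply: eq_bigr => s _.
  congr (_ * _); rewrite -actt_permt /E Cinv//; last exact: Omega_permt.
  congr (_ - _); apply: eq_bigr => i _; rewrite -actt_face phiinv//.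
  by apply: Omega_face; exact: Omega_permt.
have Ealt : alternating_on (Omega omega) (alternate E).
  by move=> s x _; exact: alternate_permt.
have phialt : alternating_on (Omega omega) (alternate phi).
  by move=> s x _; exact: alternate_permt.
have phiinv' : invariant_on omega (Omega omega) (alternate phi).
  move=> g x gS xO; rewrite /alternate; congr (_ * _); apply: eq_bigr => s _.
  by rewrite -actt_permt phiinv//; exact: Omega_permt.
have fact0 m : m`!%:R != 0 :> R by rewrite pnatr_eq0 -lt0n fact_gt0.
have CE x : Omega omega x -> C x = alternate E x + coboundary (alternate phi) x.
  move=> xO; rewrite -alternate_coboundary ?pnatr_eq0// /alternate -mulrDr.
  rewrite -big_split /=.
  under eq_bigr do rewrite -mulrDr subrK Calt// mulrA -expr2 sqrr_sign mul1r.
  by rewrite sumr_const card_Sn -[C x *+ _]mulr_natl mulKf.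
have EB x : Omega omega x -> `|alternate E x| <= B.
  move=> xO; rewrite /alternate normrM ger0_norm ?invr_ge0 ?ler0n//.
  rewrite ler_pdivrMl ?ltr0n ?fact_gt0//.
  apply: le_trans (ler_norm_sum _ _ _) _.
  apply: (@le_trans _ _ (\sum_(s : 'S_n.+1) B)).
    apply: ler_sum => s _; rewrite normrM normr_sign mul1r le_B//.
    exact: Omega_permt.
  by rewrite sumr_const card_Sn mulr_natl.
have CZ : pairing C Z = pairing (alternate E) Z.
  transitivity (pairing (alternate E) Z + pairing (coboundary (alternate phi))
    Z).
    rewrite /pairing -big_split /= big_seq [RHS]big_seq; apply: eq_bigr => p pZ.
    by rewrite -mulrDr -CE//; exact: gZ.
  rewrite -pairing_boundary (pairing_orbit_eq phiinv' phialt cZ).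
  by rewrite /pairing big_nil addr0.
have le_Z' Z' : generic omega Z' -> orbit_eq omega Z Z' ->
    `|pairing C Z| <= B * \sum_(p <- Z') `|p.1|.
  move=> gZ' eZ; rewrite CZ (pairing_orbit_eq Einv Ealt eZ) /pairing.
  apply: le_trans (ler_norm_sum _ _ _) _;
    rewrite mulr_sumr big_seq [leRHS]big_seq.
  apply: ler_sum => p pZ'; rewrite normrM mulrC ler_wpM2r// EB//; exact: gZ'.
have eZZ : orbit_eq omega Z Z.
  by exists [::] => // x; rewrite subrr big_nil.
(* Passing to the infimum divides by [B]; when [B = 0], the representative [Z] itself already gives
   the bound. *)
move: B0; rewrite le_eqVlt => /predU1P[B0|Bpos].
  by have := le_Z' Z gZ eZZ; rewrite -B0 !mul0r.
rewrite -ler_pdivrMl//; apply: lb_le_inf.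
  by exists (\sum_(p <- Z) `|p.1|), Z.
by move=> m [Z' [gZ' eZ ->]]; rewrite ler_pdivrMl//; exact: le_Z'.
Qed.

End Chains.

(** * Coboundaries and a vertex added at either end *)

Section CoboundaryShift.
Variables (T : Type) (K : comNzRingType).

Lemma coboundary_cons n (h : n.+1.-tuple T -> K) a (x : n.+1.-tuple T) :
  coboundary h (cons_tuple a x) = h x - coboundary (fun u => h (cons_tuple a
    u)) x.
Proof.
rewrite /coboundary big_ord_recl /= expr0 mul1r face_ord0 -sumrN; congr (_ + _).
by apply: eq_bigr => i _; rewrite face_lift0 /= /bump /= add1n exprS mulN1r
  mulNr.
Qed.

(** Splitting off the first vertex [a] twice cancels the terms [dh x], and leaves the double
    coboundary of [h (a, .)], in one variable fewer. *)
Lemma coboundary2 n (h : n.-tuple T -> K) (x : n.+2.-tuple T) :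
  coboundary (coboundary h) x = 0.
Proof.
elim: n h x => [|n IH] h x; case/tupleP: x => a x; rewrite coboundary_cons.
  rewrite /coboundary !big_ord_recl !big_ord0 /= !expr0 !mul1r !addr0.
  by apply/eqP; rewrite subr_eq0; apply/eqP; congr h;
    rewrite [RHS]tuple0 [LHS]tuple0.
have -> : (fun u => coboundary h (cons_tuple a u)) =
    fun u => h u - coboundary (fun v => h (cons_tuple a v)) u.
  by apply/funext => u; rewrite coboundary_cons.
rewrite {2}/coboundary; under eq_bigr do rewrite mulrBr.
by rewrite sumrB -/(coboundary h x) -/(coboundary _ x) IH subr0 subrr.
Qed.

Lemma tnth_rcons_lift n (x : n.-tuple T) y j :
  tnth (rcons_tuple x y) (lift ord_max j) = tnth x j.
Proof.
by rewrite !(tnth_nth y) /= nth_rcons size_tuple /bump (leqNgt n j) ltn_ord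
  add0n ltn_ord.
Qed.

Lemma tnth_rcons_max n (x : n.-tuple T) y : tnth (rcons_tuple x y) ord_max = y.
Proof. by rewrite (tnth_nth y) /= nth_rcons size_tuple ltnn eqxx. Qed.

Lemma face_rcons_max n (x : n.-tuple T) y : face ord_max (rcons_tuple x y) = x.
Proof. by apply: eq_from_tnth => j; rewrite tnth_mktuple tnth_rcons_lift. Qed.

Lemma face_rcons n (i : 'I_n.+1) (x : n.+1.-tuple T) y :
  face (widen_ord (leqnSn n.+1) i) (rcons_tuple x y) = rcons_tuple (face i x) y.
Proof.
apply: eq_from_tnth => j; rewrite tnth_mktuple.
have [k ->|->] := unliftP ord_max j; last first.
  rewrite tnth_rcons_max -[RHS](tnth_rcons_max x y); congr tnth; apply: val_inj.
  by rewrite /= /bump -ltnS ltn_ord add1n.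
rewrite tnth_rcons_lift tnth_mktuple -(tnth_rcons_lift x y); congr tnth.
apply: val_inj; rewrite /= /bump (leqNgt n k) ltn_ord add0n.
by rewrite (leqNgt n.+1) (ltn_ord (lift i k)) add0n.
Qed.

Lemma coboundary_rcons n (h : n.+1.-tuple T -> K) (x : n.+1.-tuple T) y :
  coboundary h (rcons_tuple x y) =
  coboundary (fun u => h (rcons_tuple u y)) x + (-1) ^+ n.+1 * h x.
Proof.
rewrite /coboundary big_ord_recr /= face_rcons_max; congr (_ + _).
by apply: eq_bigr => i _; rewrite face_rcons.
Qed.

End CoboundaryShift.

(** * Generic tuples: invariance and extension by a vertex *)

Section OmegaAction.
Variables (R : realType) (omega : {biscalar C4 R}).
Hypothesis omega_alt : alternating_form omega.
Hypothesis omega_nondeg : nondegenerate_form omega.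
Notation X := (projective R).
Local Notation w := (omega : C4 R -> C4 R -> R[i]).

Lemma line_act g (x : X) : g \in unitmx ->
  line (act g x) = (linfun (mulmx g : C4 R -> C4 R) @: line x)%VS.
Proof.
move=> gu; have [v v0 ->] := proj_surj x.
have gv0 := mulmx_unit_neq0 gu v0.
by rewrite act_proj// !projE// limg_line lfunE.
Qed.

Lemma Omega_actt n g (x : n.-tuple X) : Sp omega g ->
  Omega omega x -> Omega omega (actt g x).
Proof.
move=> [gu gw] [xw xs]; split => [i j u v ij|S cS].
  rewrite !tnth_map !line_act// => /memv_imgP[u' u'x ->] + /memv_imgP[v' v'x
    ->].
  rewrite !lfunE /= gw => u0 v0; apply: xw ij u'x _ v'x _.
    by apply: contraNneq u0 => ->; rewrite mulmx0.
  by apply: contraNneq v0 => ->; rewrite mulmx0.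
under eq_bigr do rewrite tnth_map line_act//.
rewrite -limg_sum xs//; apply/eqP; rewrite eqEsubv subvf /=; apply/subvP => v _.
apply/memv_imgP; exists (invmx g *m v); first exact: memvf.
by rewrite lfunE /= mulKVmx.
Qed.

Lemma Sp_inv g : Sp omega g -> Sp omega (invmx g).
Proof.
move=> [gu gw]; split; first by rewrite unitmx_inv.
by move=> u v; rewrite -gw !mulKVmx.
Qed.

Lemma act_inv g (x : X) : Sp omega g -> act (invmx g) (act g x) = x.
Proof.
move=> gS; have gu := gS.1; have [v v0 ->] := proj_surj x.
have gv0 := mulmx_unit_neq0 gu v0.
by rewrite act_proj// act_proj ?unitmx_inv// mulKmx.
Qed.

Lemma actt_inv n g (x : n.-tuple X) : Sp omega g ->
  actt (invmx g) (actt g x) = x.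
Proof.
by move=> gS; apply: eq_from_tnth => i; rewrite !tnth_map act_inv.
Qed.

Lemma actt_rcons n g (x : n.-tuple X) y :
  actt g (rcons_tuple x y) = rcons_tuple (actt g x) (act g y).
Proof. by apply: val_inj; rewrite /= map_rcons. Qed.

Lemma Omega_rcons n (x : n.-tuple X) (v : C4 R) : (4 <= n)%N -> v != 0 ->
  Omega omega x ->
  (forall i, w (rep (tnth x i)) v != 0) ->
  (forall S : {set 'I_n}, #|S| = 3 -> v \notin (\sum_(i in S) line (tnth x
    i))%VS) ->
  Omega omega (rcons_tuple x (proj v)).
Proof.
move=> n4 v0 [xw xs] wv vS; split => [i j a b ij|S cS].
  have key k (a' b' : C4 R) : a' \in line (tnth x k) -> a' != 0 ->
      b' \in line (proj v) -> b' != 0 -> w a' b' != 0.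
    rewrite projE// -{1}(repK (tnth x k)) projE ?rep_neq0//.
    move=> /vlineP[s ->] a0 /vlineP[t ->] b0.
    rewrite (@omegaZ R omega) (@omegaZr R omega) !mulf_neq0//.
      by apply: contraNneq a0 => ->; rewrite scale0r.
    by apply: contraNneq b0 => ->; rewrite scale0r.
  have [i' iE|iE] := unliftP ord_max i; have [j' jE|jE] := unliftP ord_max j.
  - rewrite iE jE !tnth_rcons_lift; apply: xw; apply: contraNneq ij => e.
    by rewrite iE jE e.
  - by rewrite iE jE tnth_rcons_lift tnth_rcons_max; exact: key.
  - rewrite iE jE tnth_rcons_lift tnth_rcons_max => av a0 bx b0.
    by rewrite (alternatingC (@omegaD R omega) (@omegaDr R omega) omega_alt)
      oppr_eq0; exact: (key j').
  - by rewrite iE jE eqxx in ij.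
pose S' : {set 'I_n} := finset (fun i => lift ord_max i \in S).
have liftS' : lift ord_max @: S' = S :\ ord_max.
  apply/setP => i; rewrite !inE; apply/imsetP/andP => [[j jS' ->]|[im iS]].
    by rewrite inE in jS'; rewrite eq_sym neq_lift.
  have [j iE|iE] := unliftP ord_max i; last by rewrite iE eqxx in im.
  by exists j; rewrite // inE -iE.
have cS' : #|S'| = #|S :\ ord_max| by rewrite -liftS' card_imset//;
  exact: lift_inj.
have sumS' : (\sum_(i in S :\ ord_max) line (tnth (rcons_tuple x (proj v))
  i))%VS =
    (\sum_(i in S') line (tnth x i))%VS.
  rewrite -liftS' big_imset /=; last by move=> i j _ _; exact: lift_inj.
  by apply: eq_bigr => i _; rewrite tnth_rcons_lift.
have [mS|mS] := boolP (ord_max \in S); last first.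
  have SE : S :\ ord_max = S by apply/finset.setDidPl;
    rewrite disjoint_sym disjoints1.
  by rewrite -SE sumS'; apply: xs; rewrite cS' SE.
have cS3 : #|S'| = 3 by move: cS; rewrite (cardsD1 ord_max) mS add1n cS' => -[].
rewrite (big_setD1 ord_max)//= sumS' tnth_rcons_max projE//.
(* As [n] is at least 4 there is an index outside [S']. Adding its line yields all of [V], so the
   three lines of [S'] span a space of dimension at least 3, and [v] lies outside it. *)
have [k kS'] : exists k, k \notin S'.
  apply/existsP; rewrite -negb_forall; apply/negP => /forallP h.
  have : (#|'I_n| <= #|S'|)%N by apply: subset_leq_card;
    apply/fintype.subsetP => i _; exact: h.
  by rewrite card_ord cS3 leqNgt n4.
have dimU : (3 <= \dim (\sum_(i in S') line (tnth x i))%VS)%N.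
  have := xs (k |: S'); rewrite cardsU1 kS' cS3 => /(_ erefl).
  rewrite big_setU1//= => e.
  have := dimv_add_leqif (line (tnth x k)) (\sum_(i in S') line (tnth x i))%VS.
  by rewrite e dim_C4 (eqP (line_dim _)) => -[].
have dis : (<[v]> :&: \sum_(i in S') line (tnth x i))%VS = 0%VS.
  apply/eqP; rewrite -subv0; apply/subvP => u;
    rewrite memv_cap => /andP[/vlineP[t ->]].
  have [-> _|t0] := eqVneq t 0; first by rewrite scale0r mem0v.
  move=> /(memvZ t^-1); rewrite scalerA mulVf// scale1r => vU.
  by have := vS _ cS3; rewrite vU.
apply/eqP; rewrite eqEdim subvf dim_C4 dimv_disjoint_sum//.
by rewrite dim_vline v0 add1n ltnS.
Qed.

End OmegaAction.

(** * An invariant version of the cochain *)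

Lemma ae_tuple_forall d (T : measurableType d) (R : realType)
    (m : {sigma_finite_measure set T -> \bar R}) n (Q : set T) :
  (\forall y \ae m, Q y) ->
  \forall y \ae tuple_measure m n, forall i, Q (tnth y i).
Proof.
move=> [N [mN N0 QN]].
pose P k := [set y : k.-tuple T | forall i, ~ N (tnth y i)].
have mP k : measurable (P k).
  rewrite (_ : P k = \bigcap_(i in [set: 'I_k])
      (fun y : k.-tuple T => tnth y i) @^-1` (~` N)).
    apply: fin_bigcap_measurable => // i _; rewrite -[X in measurable X]setTI.
    by apply: measurable_tnth => //; exact: measurableC.
  by apply/seteqP; split => y h i; [move=> _|]; exact: h.
have : \forall y \ae tuple_measure m n, P n y.
  elim: n => [|n IH]; first by apply: nearW => y [].
  apply: ae_cons_tuple => //; exists N; split => // a /= ha;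
    apply: contrapT => Na.
  apply: ha; apply: ae_imp IH => t ht i.
  by have [j ->|->] := unliftP ord0 i; rewrite ?tnthS ?tnth0.
by apply: ae_imp => y h i; apply: contrapT => nQ; exact: (h i (QN _ nQ)).
Qed.

Section FrameAction.
Variables (R : realType) (omega : {biscalar C4 R}).
Hypothesis omega_alt : alternating_form omega.
Hypothesis omega_nondeg : nondegenerate_form omega.
Notation X := (projective R).
Local Notation w := (omega : C4 R -> C4 R -> R[i]).
Local Notation V4 := ((4 + 4).-tuple (measurableTypeR R)).
Variables (nu : {sigma_finite_measure set V4 -> \bar R})
  (mu : {sigma_finite_measure set X -> \bar R}).
Hypothesis ae_row : forall r : 'rV[R[i]]_4, r != 0 ->
  \forall y \ae nu, r *m cvec y != 0.
Hypothesis nu_gmap : forall g, g \in unitmx -> nonsingular nu nu (gmap g).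

Definition pr (y : V4) : X := proj (@cvec R 4 y).
Definition prt n (y : n.-tuple V4) : n.-tuple X := [tuple of map pr y].
Definition gmapt n g (y : n.-tuple V4) : n.-tuple V4 := [tuple of map (gmap g)
  y].

Hypothesis nu_pr : nonsingular nu mu pr.

Lemma ae_prt n (P : set (n.-tuple X)) : (\forall x \ae tuple_measure mu n,
  P x) ->
  \forall y \ae tuple_measure nu n, P (prt y).
Proof. exact/nonsingular_ae/nonsingular_map_tuple. Qed.

Lemma ae_gmapt n g (P : set (n.-tuple V4)) : g \in unitmx ->
  (\forall y \ae tuple_measure nu n, P y) ->
  \forall y \ae tuple_measure nu n, P (gmapt g y).
Proof. by move=> gu; exact/nonsingular_ae/nonsingular_map_tuple/nu_gmap. Qed.

Lemma pr_gmap g y : g \in unitmx -> @cvec R 4 y != 0 -> pr (gmap g y) = act g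
  (pr y).
Proof. by move=> gu y0; rewrite /pr act_proj// /gmap tuple_of_cvecK. Qed.

Lemma ae_Omega_rcons n (x : n.-tuple X) : (4 <= n)%N -> Omega omega x ->
  \forall y \ae nu, Omega omega (rcons_tuple x (pr y)).
Proof.
move=> n4 xO.
have h1 : \forall y \ae nu, forall i, w (rep (tnth x i)) (@cvec R 4 y) != 0.
  by apply: filter_forall => i; apply: ae_omega_neq0 => //; exact: rep_neq0.
have h2 : \forall y \ae nu, forall S : {set 'I_n}, #|S| = 3 ->
    @cvec R 4 y \notin (\sum_(i in S) line (tnth x i))%VS.
  apply: filter_forall => S; have [cS|cS] := eqVneq #|S| 3; last first.
    by apply: nearW => y e; rewrite e eqxx in cS.
  (* Vectors on the three lines form a 4 by 3 matrix, whose left kernel contains a nonzero row [r]: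
     the equation of a hyperplane through these lines. *)
  pose M : 'M[R[i]]_(4, #|S|) := \matrix_(i, j) rep (tnth x (enum_val j)) i 0.
  have kM : kermx M != 0.
    rewrite kermx_eq0 /row_free; apply/negP => /eqP e.
    by have := rank_leq_col M; rewrite e cS.
  pose r := nz_row (kermx M).
  have r0 : r != 0 by rewrite nz_row_eq0.
  have rM : r *m M = 0 by apply/sub_kermxP; exact: nz_row_sub.
  apply: ae_imp (ae_row r0) => y ry _; apply: contraNN ry.
  move=> /memv_sumP[u uS ->]; rewrite mulmx_sumr big1// => i iS.
  have := uS i iS; rewrite -{1}(repK (tnth x i)) projE ?rep_neq0// => /vlineP[k
    ->].
  rewrite -scalemxAr; suff -> : r *m rep (tnth x i) = 0 by rewrite scaler0.
  apply/matrixP => a b; rewrite !ord1 [RHS]mxE.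
  have /matrixP/(_ 0 (enum_rank_in iS i)) := rM; rewrite !mxE => e;
    rewrite -[RHS]e.
  by apply: eq_bigr => j _; rewrite !mxE enum_rankK_in.
apply: filterS3 (ae_neq0 ae_row) h1 h2 => y y0 hy1 hy2.
exact: Omega_rcons.
Qed.

Variables (d : 'I_4 -> C4 R) (c : R[i]).
Hypotheses (c0 : c != 0) (dd : darboux w c d).

Definition kactt n p (x : n.-tuple X) : n.-tuple X := [tuple of map (kact omega
  d p) x].

Lemma kactt_actt n g p (x : n.-tuple X) : Sp omega g ->
  kactt (gmapt g p) (actt g x) = kactt p x.
Proof. by move=> gS; apply: eq_from_tnth => i; rewrite !tnth_map kact_Sp. Qed.

Lemma kactt_in_Sp p : pscal omega p != 0 ->
  exists2 g, Sp omega g & forall n (x : n.-tuple X), kactt p x = actt g x.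
Proof.
move=> p0; have [g gS gE] := kact_in_Sp omega_alt omega_nondeg c0 dd p0.
by exists g => // n x; apply: eq_from_tnth => i; rewrite !tnth_map.
Qed.

(** The exceptional null set of the hypothesis depends on [g]. Almost every [p] gives some [g] in
    [Sp], so the property holds for almost all [p] and then almost all [y]; joint measurability
    allows the order to be exchanged, and a single [y] becomes good for almost all [p]. *)
Lemma ae_kactt_swap n (A : set (n.-tuple X * n.-tuple X)) : measurable A ->
  (forall g, Sp omega g ->
     \forall y \ae tuple_measure nu n, A (actt g (prt y), prt y)) ->
  \forall y \ae tuple_measure nu n, \forall p \ae tuple_measure nu 4,
    A (kactt p (prt y), prt y).
Proof.
move=> mA hA; pose Q := 4.-tuple V4.
(* [K] uses the vectors of [y] themselves in place of the arbitrary choice [rep], which makes it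
   measurable; it agrees with [kactt] as soon as these vectors are nonzero. *)
pose K (q : Q * n.-tuple V4) : n.-tuple X :=
  [tuple proj (kvec omega d q.1 (@cvec R 4 (tnth q.2 i))) | i < n].
have mK : measurable_fun setT K.
  apply/measurable_fun_tnthP => i; rewrite (_ : _ \o K =
      fun q => proj (kvec omega d q.1 (@cvec R 4 (tnth q.2 i)))).
    apply: measurable_proj_of; apply: vmeasurable_kvec;
      first exact: measurable_fst.
    apply: vmeasurable_cvec.
    exact: (measurableT_comp (measurable_tnth i) measurable_snd).
  by apply/funext => q /=; rewrite tnth_mktuple.
have mprt : measurable_fun setT (@prt n).
  by apply: measurable_map_tuple; exact: nu_pr.1.
have mE : measurable [set q | A (K q, prt q.2)].
  have mKp : measurable_fun setT (fun q => (K q, prt q.2)).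
    apply: measurable_fun_pair mK _.
    exact: (measurableT_comp mprt measurable_snd).
  by rewrite -[X in measurable X]setTI; exact: mKp.
have KE p (y : n.-tuple V4) : (forall i, @cvec R 4 (tnth y i) != 0) ->
    K (p, y) = kactt p (prt y).
  move=> y0; apply: eq_from_tnth => i; rewrite tnth_mktuple !tnth_map /pr.
  by rewrite kact_proj.
have n0 := ae_tuple_forall n (ae_neq0 ae_row).
have h : \forall p \ae tuple_measure nu 4, \forall y \ae tuple_measure nu n,
    A (K (p, y), prt y).
  apply: ae_imp (ae_pscal omega_alt omega_nondeg ae_row) => p p0.
  have [g gS gE] := kactt_in_Sp p0.
  by apply: filterS2 n0 (hA g gS) => y y0; rewrite KE// gE.
have := ae_swap mE h; apply: filterS2 n0 => y y0; apply: ae_imp => p /=.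
by rewrite KE.
Qed.

Hypothesis nu_gt0 : (0 < nu setT)%E.

Lemma ae_ex (n : nat) (P : set (n.-tuple V4)) :
  (\forall y \ae tuple_measure nu n, P y) -> exists y, P y.
Proof.
move=> h; have := tuple_measure_setT_gt0 n nu_gt0.
by move=> /ae_properfilter_algebraOfSetsType => pf; exact: (filter_ex h).
Qed.

Lemma ae_ex1 (P : set V4) : (\forall y \ae nu, P y) -> exists y, P y.
Proof.
by move=> h; have pf := ae_properfilter_algebraOfSetsType nu_gt0;
  exact: (filter_ex h).
Qed.

Section Extension.
Variables (n : nat) (f : n.-tuple X -> R).

Definition orbit_values (x : n.-tuple X) : set R :=
  [set r | \forall p \ae tuple_measure nu 4, f (kactt p x) = r].

(* The value of [f] on almost all of the orbit of [x] (0 if there is none):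
   a version of [f] that is exactly invariant. *)
Definition orbit_version (x : n.-tuple X) : R := xget 0 (orbit_values x).

(** Replacing [p] by [g p] preserves null sets and [K_(g p) g = K_p], so [x] and [g x] have the same
    set of orbit values; this holds at every [x], also where that set is empty. *)
Lemma orbit_version_inv g x : Sp omega g -> orbit_version (actt g x) =
  orbit_version x.
Proof.
have sub h y : Sp omega h -> orbit_values (actt h y) `<=` orbit_values y.
  move=> hS r; rewrite /orbit_values /= => /(ae_gmapt hS.1).
  by apply: ae_imp => p; rewrite kactt_actt.
move=> gS; rewrite /orbit_version; congr xget; apply/seteqP; split.
  exact: sub.
rewrite -{1}(actt_inv x gS); apply: sub; exact: Sp_inv.
Qed.

Hypothesis mf : measurable_fun setT f.
Hypothesis f_inv : forall g, Sp omega g ->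
  \forall x \ae tuple_measure mu n, f (actt g x) = f x.

(** By [ae_kactt_swap] applied to the relation [f q.1 = f q.2], the number [f (prt y)] is an orbit
    value for almost every [y]. *)
Lemma ae_orbit_version : \forall y \ae tuple_measure nu n,
  \forall p \ae tuple_measure nu 4, f (kactt p (prt y)) = orbit_version (prt y).
Proof.
have mA : measurable [set q : n.-tuple X * n.-tuple X | f q.1 = f q.2].
  have m1 : measurable_fun setT (fun q : n.-tuple X * n.-tuple X => f q.1 - f
    q.2).
    apply: measurable_funB.
      exact: (measurableT_comp mf measurable_fst).
    exact: (measurableT_comp mf measurable_snd).
  rewrite (_ : mkset _ = setT `&`
      (fun q : n.-tuple X * n.-tuple X => f q.1 - f q.2) @^-1` [set 0]).
    exact: m1.
  rewrite setTI; apply/seteqP; split => q /=; first by move=> ->; rewrite subrr.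
  by move=> /eqP; rewrite subr_eq0 => /eqP.
have := ae_kactt_swap mA (fun g gS => ae_prt (f_inv gS)).
by apply: ae_imp => y h; apply: (@xgetPex _ 0 (orbit_values (prt y)));
  exists (f (prt y)).
Qed.

End Extension.

Section Cochain.
Variables (n : nat) (C : n.+1.-tuple X -> R) (f : n.-tuple X -> R) (B : R).
Hypothesis C_inv : invariant_on omega (Omega omega) C.
Hypothesis mf : measurable_fun setT f.
Hypothesis f_inv : forall g, Sp omega g ->
  \forall x \ae tuple_measure mu n, f (actt g x) = f x.
Hypothesis C_near : \forall x \ae tuple_measure mu n.+1,
  Omega omega x -> `|C x - coboundary f x| <= B.

Local Notation F := (orbit_version f).

Definition near_coboundary (x : n.+1.-tuple X) :=
  Omega omega x -> `|C x - coboundary F x| <= B.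

Lemma prt_face m i (y : m.+1.-tuple V4) : prt (face i y) = face i (prt y).
Proof. by apply: eq_from_tnth => j; rewrite tnth_map !tnth_mktuple tnth_map.
  Qed.

(** For almost every [y] one [p] can be found such that [K_p (prt y)] avoids the exceptional set and
    [f] takes its orbit value at all faces. As [K_p] acts as some [g] in [Sp], the estimate at
    [g (prt y)] is the one wanted at [prt y]. *)
Lemma ae_near_coboundary :
  \forall y \ae tuple_measure nu n.+1, near_coboundary (prt y).
Proof.
have [N [mN N0 hN]] := C_near.
have aeN : \forall x \ae tuple_measure mu n.+1, ~ N x.
  by exists N; split => // x /= /contrapT.
have swapN : \forall y \ae tuple_measure nu n.+1,
    \forall p \ae tuple_measure nu 4, ~ N (kactt p (prt y)).
  apply: (ae_kactt_swap (A := [set q | ~ N q.1])).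
    apply: measurableC; rewrite -[X in measurable X]setTI.
    exact: measurable_fst.
  move=> g gS; have := ae_gmapt gS.1 (ae_prt aeN).
  apply: filterS2 (ae_tuple_forall n.+1 (ae_neq0 ae_row)) => y y0 /=.
  rewrite (_ : prt (gmapt g y) = actt g (prt y))//.
  by apply: eq_from_tnth => i; rewrite !tnth_map pr_gmap// gS.1.
have faces : \forall y \ae tuple_measure nu n.+1, forall i,
    \forall p \ae tuple_measure nu 4,
      f (kactt p (prt (face i y))) = F (prt (face i y)).
  apply: filter_forall => i.
  exact: (nonsingular_ae (nonsingular_face nu i) (ae_orbit_version mf f_inv)).
apply: filterS2 swapN faces => y hN' hf xO.
have hf' : \forall p \ae tuple_measure nu 4, forall i,
    f (kactt p (prt (face i y))) = F (prt (face i y)).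
  exact: filter_forall.
have [p [p0 Np fp]] : exists p, [/\ pscal omega p != 0, ~ N (kactt p (prt y)) &
    forall i, f (kactt p (prt (face i y))) = F (prt (face i y))].
  apply: ae_ex; apply: filterS3 (ae_pscal omega_alt omega_nondeg ae_row) hN'
    hf'.
  by move=> p *; split.
have [g gS gE] := kactt_in_Sp p0.
have : Omega omega (actt g (prt y)) ->
    `|C (actt g (prt y)) - coboundary f (actt g (prt y))| <= B.
  by apply: contrapT => h; apply: Np; rewrite gE; exact: hN.
rewrite C_inv// => /(_ (Omega_actt gS xO)).
rewrite (_ : coboundary f _ = coboundary F (prt y))//.
by apply: eq_bigr => i _; rewrite -actt_face -gE -prt_face fp.
Qed.

End Cochain.

End FrameAction.

(** * The bounded homotopy *)

Section Homotopy.
Variables (R : realType) (omega : {biscalar C4 R}).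
Hypothesis omega_alt : alternating_form omega.
Hypothesis omega_nondeg : nondegenerate_form omega.
Notation X := (projective R).
Local Notation w := (omega : C4 R -> C4 R -> R[i]).
Local Notation V4 := ((4 + 4).-tuple (measurableTypeR R)).
Variable nu : {sigma_finite_measure set V4 -> \bar R}.
Hypothesis ae_row : forall r : 'rV[R[i]]_4, r != 0 ->
  \forall y \ae nu, r *m cvec y != 0.
Hypothesis nu_gmap : forall g, g \in unitmx -> nonsingular nu nu (gmap g).
Hypothesis nu_gt0 : (0 < nu setT)%E.

(* [Sp] is transitive on the triples in general position, so a property which is
   invariant and holds almost everywhere can be fixed in its first three
   arguments. *)
Lemma ae_fixed_triple (P : set (5.-tuple X)) (t : 3.-tuple X) :
  (forall g x, Sp omega g -> P x -> P (actt g x)) ->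
  (\forall y \ae tuple_measure nu 5, P (prt y)) ->
  form_scal w (rep (tnth t 0)) (rep (tnth t 1)) (rep (tnth t 2)) != 0 ->
  radical w (rep (tnth t 0)) (rep (tnth t 1)) (rep (tnth t 2)) != 0 ->
  \forall a \ae nu, \forall b \ae nu,
    P (rcons_tuple (rcons_tuple t (pr a)) (pr b)).
Proof.
move=> Pinv aeP st rt.
have h1 := @ae_tuple_cons _ _ _ nu 4 _ aeP.
(* A generic triple [y1], [y2], [y3] is picked for which [P] holds at almost all completions. Some
   [g] takes it to [t], and [invmx g] is nonsingular, so almost all [a], [b] are images under [g] of
   good completions. *)
have [y1 [h1y h1t]] := ae_ex1 nu_gt0 (filterI h1 (ae_triple omega_alt
  omega_nondeg ae_row)).
have h2 := @ae_tuple_cons _ _ _ nu 3 _ h1y.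
have [y2 [h2y h2t]] := ae_ex1 nu_gt0 (filterI h2 h1t).
have h3 := @ae_tuple_cons _ _ _ nu 2 _ h2y.
have [y3 [h3y [s3 r3]]] := ae_ex1 nu_gt0 (filterI h3 h2t).
have [g gS [g1 g2 g3]] := triple_transitive omega_alt omega_nondeg s3 r3 st rt.
have gu := gS.1; have gu' : invmx g \in unitmx by rewrite unitmx_inv.
have h4 := @ae_tuple_cons _ _ _ nu 1 _ h3y.
have prg a : @cvec R 4 a != 0 -> act g (pr (gmap (invmx g) a)) = pr a.
  move=> a0; rewrite pr_gmap//.
  have := act_inv (pr a) (Sp_inv gS); by rewrite invmxK.
apply: filterS2 (ae_neq0 ae_row) (nonsingular_ae (nu_gmap gu') h4) => a a0 h5.
have h6 := @ae_tuple_cons _ _ _ nu 0 _ h5.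
apply: filterS2 (ae_neq0 ae_row) (nonsingular_ae (nu_gmap gu') h6) => b b0 h7.
have [e Pe] := ae_ex nu_gt0 h7.
have {}g1 : act g (pr y1) = tnth t 0 by rewrite g1 repK.
have {}g2 : act g (pr y2) = tnth t 1 by rewrite g2 repK.
have {}g3 : act g (pr y3) = tnth t 2 by rewrite g3 repK.
have := Pinv g _ gS Pe; congr (P _); apply: val_inj.
case: e {Pe} => -[|//] _ /=.
transitivity [:: tnth t 0; tnth t 1; tnth t 2; pr a; pr b].
  exact: (congr2 cons g1 (congr2 cons g2 (congr2 cons g3
    (congr2 cons (prg a a0) (congr2 cons (prg b b0) erefl))))).
by case: t {st rt g1 g2 g3} => -[|t0 [|t1 [|t2 [|]]]].
Qed.

Lemma rep_line (x : X) : rep x \in line x. Proof. exact: memv_pick. Qed.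

(** A zero radical would put the third line in the sum of the first two, and with the omitted line
    of [t] the four would span at most dimension 3. *)
Lemma Omega_face_triple (t : 4.-tuple X) l : Omega omega t ->
  let u := face l t in
  form_scal w (rep (tnth u 0)) (rep (tnth u 1)) (rep (tnth u 2)) != 0 /\
  radical w (rep (tnth u 0)) (rep (tnth u 1)) (rep (tnth u 2)) != 0.
Proof.
move=> [tw ts] u; pose r (k : 'I_3) := rep (tnth u k).
have uw (j k : 'I_3) : j != k -> w (r j) (r k) != 0.
  move=> jk; rewrite /r /u !tnth_mktuple.
  by apply: tw (rep_line _) (rep_neq0 _) (rep_line _) (rep_neq0 _);
    rewrite (inj_eq (@lift_inj _ l)).
split; first by rewrite !mulf_neq0// -/(r 0) -/(r 1) -/(r 2) uw.
apply/negP => /eqP r0.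
pose L0 := line (tnth u 0); pose L1 := line (tnth u 1);
  pose L2 := line (tnth u 2).
have r2 : rep (tnth u 2) \in (L0 + L1)%VS.
  have -> : rep (tnth u 2) = (w (r 0) (r 1))^-1 *:
      (w (r 0) (r 2) *: r 1 - w (r 1) (r 2) *: r 0).
    have w01 : w (r 0) (r 1) != 0 by rewrite uw.
    apply: (scalerI w01); rewrite scalerA mulfV// scale1r.
    by apply/eqP; rewrite -subr_eq0 opprB addrC; apply/eqP.
  by rewrite memvZ// addrC memv_add// ?memvN memvZ// rep_line.
have lu2 : (L2 <= L0 + L1)%VS.
  by rewrite /L2 -[X in line X](repK (tnth u 2)) projE ?rep_neq0// -memvE.
have full : (line (tnth t l) + (L0 + L1))%VS = fullv.
  apply/eqP; rewrite eqEsubv subvf /= -(ts (finset.setTfor 'I_4)); last first.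
    by rewrite cardsT card_ord.
  apply/subv_sumP => k _; have [j ->|->] := unliftP l k; last exact: addvSl.
  apply: subv_trans (addvSr _ _); rewrite (_ : tnth t (lift l j) = tnth u j);
    last first.
    by rewrite tnth_mktuple.
  have : [\/ j = 0, j = 1 | j = 2].
    by case: j => -[|[|[|]]]// h; [apply: Or31|apply: Or32|apply: Or33];
      exact: val_inj.
  by case=> ->; [exact: addvSl|exact: addvSr|].
have := (dimv_add_leqif L0 L1).1.
have := (dimv_add_leqif (line (tnth t l)) (L0 + L1)%VS).1.
rewrite full dim_C4 !(eqP (line_dim _)) => h1 h2.
by have := leq_trans h1 (leq_add (leqnn 1) h2).
Qed.

(** The supremum is the essential infimum of [g]. For a good [a], [g a - K] is an essential lower
    bound and [g a + K] exceeds all of them, so the constant stays [K]. *)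
Lemma ae_near_sup (g : V4 -> R) K :
  (\forall a \ae nu, \forall b \ae nu, `|g a - g b| <= K) ->
  \forall a \ae nu, `|g a - sup [set r | \forall b \ae nu, r <= g b]| <= K.
Proof.
set S := [set r | _]; apply: ae_imp => a ha.
have Sa : S (g a - K).
  by apply: ae_imp ha => b; rewrite ler_norml => /andP[_]; lra.
have Sub : ubound S (g a + K).
  move=> r Sr; have [b [rb hb]] := ae_ex1 nu_gt0 (filterI Sr ha).
  by move: hb rb; rewrite ler_norml => /andP[+ _]; lra.
have h1 : sup S <= g a + K by apply: ge_sup Sub; exists (g a - K).
have h2 : g a - K <= sup S by apply: ub_le_sup => //; exists (g a + K).
by rewrite ler_norml; apply/andP; split; lra.
Qed.

Lemma coboundaryB n (a b : n.-tuple X -> R) x :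
  coboundary (fun u => a u - b u) x = coboundary a x - coboundary b x.
Proof. by rewrite /coboundary -sumrB; apply: eq_bigr => i _; rewrite mulrBr.
  Qed.

Lemma le_norm_coboundary n (a : n.-tuple X -> R) B x :
  (forall i, `|a (face i x)| <= B) -> `|coboundary a x| <= n.+1%:R * B.
Proof.
move=> aB; apply: le_trans (ler_norm_sum _ _ _) _.
apply: (@le_trans _ _ (\sum_(i < n.+1) B)).
  by apply: ler_sum => i _; rewrite normrM normrX normrN1 expr1n mul1r.
by rewrite sumr_const card_ord mulr_natl.
Qed.

Variables (C : 5.-tuple X -> R) (F : 4.-tuple X -> R) (B : R).
Hypothesis C_inv : invariant_on omega (Omega omega) C.
Hypothesis C_cocycle : forall x : 6.-tuple X,
  Omega omega x -> coboundary C x = 0.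
Hypothesis F_inv : forall g x, Sp omega g -> F (actt g x) = F x.
Hypothesis C_near : \forall y \ae tuple_measure nu 5,
  Omega omega (prt y) -> `|C (prt y) - coboundary F (prt y)| <= B.

(** By [coboundary_rcons] this equals [F t] plus the defect [C - dF] at [(t, y)]. *)
Definition homotopy (y : V4) (t : 4.-tuple X) : R :=
  C (rcons_tuple t (pr y)) - coboundary (fun u => F (rcons_tuple u (pr y))) t.

(** In [dC (x, y) = 0] the face that drops [y] is [C x] with sign [(-1)^5]; the term in [F] is a
    double coboundary. *)
Lemma coboundary_homotopy y (x : 5.-tuple X) : Omega omega (rcons_tuple x (pr
  y)) ->
  C x = coboundary (homotopy y) x.
Proof.
move=> xyO; rewrite coboundaryB coboundary2 subr0.
have := C_cocycle xyO; rewrite coboundary_rcons => /eqP.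
by rewrite -signr_odd /= expr1 mulN1r subr_eq0 => /eqP.
Qed.

(** With [E = C - dF], the left side is [E (t, a) - E (t, b)]. In [dE (t, a, b) = 0] these are the
    two faces that drop [b] and [a], and the remaining four form the right side. *)
Lemma homotopy_sub a b (t : 4.-tuple X) :
  Omega omega (rcons_tuple (rcons_tuple t (pr a)) (pr b)) ->
  homotopy a t - homotopy b t =
  coboundary (fun u => C (rcons_tuple (rcons_tuple u (pr a)) (pr b)) -
    coboundary F (rcons_tuple (rcons_tuple u (pr a)) (pr b))) t.
Proof.
move=> O6; rewrite /homotopy.
have -> : (fun u : 3.-tuple X => C (rcons_tuple (rcons_tuple u (pr a)) (pr b)) -
    coboundary F (rcons_tuple (rcons_tuple u (pr a)) (pr b))) =
  fun u => C (rcons_tuple (rcons_tuple u (pr a)) (pr b)) -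
    (coboundary (fun v => F (rcons_tuple (rcons_tuple v (pr a)) (pr b))) u
     - (F (rcons_tuple u (pr b)) - F (rcons_tuple u (pr a)))).
  apply/funext => u; rewrite 2!coboundary_rcons -!(signr_odd _ 3) -(signr_odd _
    4) /=.
  by rewrite expr0 expr1 mul1r mulN1r; congr (_ - _);
    rewrite opprB addrA addrAC.
rewrite 3!coboundaryB coboundary2.
have := C_cocycle O6; rewrite 2!coboundary_rcons.
rewrite -(signr_odd _ 5) -(signr_odd _ 4) /= expr0 expr1 mul1r mulN1r.
by move=> /eqP; rewrite subr_eq0 => /eqP <-; ring.
Qed.

Lemma ae_homotopy_close (t : 4.-tuple X) : Omega omega t ->
  \forall a \ae nu, \forall b \ae nu, `|homotopy a t - homotopy b t| <= 4 * B.
Proof.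
move=> tO.
pose P (x : 5.-tuple X) := Omega omega x -> `|C x - coboundary F x| <= B.
have Pinv g x : Sp omega g -> P x -> P (actt g x).
  move=> gS Px gxO; have xO : Omega omega x.
    by rewrite -(actt_inv x gS); apply: Omega_actt => //; exact: Sp_inv.
  rewrite C_inv// (_ : coboundary F _ = coboundary F x); first exact: Px.
  by apply: eq_bigr => i _; rewrite -actt_face F_inv.
have hl : \forall a \ae nu, forall l : 'I_4, \forall b \ae nu,
    P (rcons_tuple (rcons_tuple (face l t) (pr a)) (pr b)).
  apply: filter_forall => l; have [st rt] := Omega_face_triple l tO.
  exact: ae_fixed_triple.
have h5 := ae_Omega_rcons omega_alt omega_nondeg ae_row (isT : (4 <= 4)%N) tO.
apply: filterS2 hl h5 => a hla O5.
have hb : \forall b \ae nu, forall l : 'I_4,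
    P (rcons_tuple (rcons_tuple (face l t) (pr a)) (pr b)) by exact:
      filter_forall.
have h6 := ae_Omega_rcons omega_alt omega_nondeg ae_row (isT : (4 <= 5)%N) O5.
apply: filterS2 hb h6 => b hlb O6; rewrite homotopy_sub//.
apply: le_norm_coboundary => l; apply: hlb.
by rewrite -2!face_rcons; exact: Omega_face.
Qed.

(** An essential infimum over [y] is canonical, hence invariant; [homotopy y] for one chosen [y]
    would only be invariant under the stabiliser of its line. *)
Definition primitive (t : 4.-tuple X) : R :=
  sup [set r | \forall y \ae nu, r <= homotopy y t].

Lemma ae_primitive_near (t : 4.-tuple X) : Omega omega t ->
  \forall y \ae nu, `|homotopy y t - primitive t| <= 4 * B.
Proof. by move=> /ae_homotopy_close; exact: ae_near_sup. Qed.

(** The change of variable from [y] to [g y] is nonsingular, and [homotopy] is unchanged when [y]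
    and [t] are moved together, provided that [(t, y)] is generic. *)
Lemma primitive_inv : invariant_on omega (Omega omega) primitive.
Proof.
pose S t : set R := [set r | \forall y \ae nu, r <= homotopy y t].
have sub g t : Sp omega g -> Omega omega t -> S (actt g t) `<=` S t.
  move=> gS tO r /= /(nonsingular_ae (nu_gmap gS.1)).
  have h5 := ae_Omega_rcons omega_alt omega_nondeg ae_row (isT : (4 <= 4)%N) tO.
  apply: filterS3 (ae_neq0 ae_row) h5 => y y0 O5.
  suff -> : homotopy (gmap g y) (actt g t) = homotopy y t by [].
  rewrite /homotopy pr_gmap ?gS.1// -actt_rcons C_inv//; congr (_ - _).
  by apply: eq_bigr => i _; rewrite -actt_face -actt_rcons F_inv.
move=> g t gS tO; rewrite /primitive -/(S t) -/(S (actt g t)); congr sup.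
apply/seteqP; split; first exact: sub.
rewrite -{1}(actt_inv t gS); apply: sub; first exact: Sp_inv.
exact: Omega_actt.
Qed.

(** One [y] serves all five faces of [x]: there [C x] is the coboundary of [homotopy y], and
    exchanging this for [primitive] costs [4 * B] per face. *)
Lemma primitive_close (x : 5.-tuple X) : Omega omega x ->
  `|C x - coboundary primitive x| <= 20 * B.
Proof.
move=> xO.
have h6 := ae_Omega_rcons omega_alt omega_nondeg ae_row (isT : (4 <= 5)%N) xO.
have hf : \forall y \ae nu, forall i,
    `|homotopy y (face i x) - primitive (face i x)| <= 4 * B.
  by apply: filter_forall => i; apply: ae_primitive_near; exact: Omega_face.
have [y [xyO hy]] := ae_ex1 nu_gt0 (filterI h6 hf).
rewrite (coboundary_homotopy xyO) -coboundaryB.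
rewrite (_ : 20 * B = 5%:R * (4 * B)); last by ring.
exact: le_norm_coboundary.
Qed.

End Homotopy.

Lemma ae_le_Lnorm_infty d (T : measurableType d) (R : realType)
    (m : {measure set T -> \bar R}) (F : T -> R) : finite_norm m +oo%E F ->
  \forall x \ae m, `|F x| <= fine ('N[m]_+oo[EFin \o F])%E.
Proof.
rewrite /finite_norm => Foo.
(* The infinity norm is the essential supremum of the modulus when [m] is nonzero; for [m = 0] every
   property holds almost everywhere. *)
have [m0|m0] := eqVneq (m setT) 0%E; first exact: measure0_ae.
have mpos : (0 < m setT)%E by rewrite lt0e m0 measure_ge0.
have fN : ('N[m]_+oo[EFin \o F])%E \is a fin_num.
  by rewrite ge0_fin_numE ?Lnorm_ge0.
have := ess_sup_ge m (abse \o (EFin \o F)).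
apply: ae_imp => x; rewrite -lee_fin fineK// unlock mpos.
by [].
Qed.

Theorem theorem6p1 (R : realType) (omega : {biscalar C4 R})
    (omega_alt : alternating_form omega)
    (omega_nondeg : nondegenerate_form omega)
    (mu : {sigma_finite_measure set (projective R) -> \bar R})
    (mu_smooth : smooth_measure_class mu)
    (C : 5.-tuple (projective R) -> R)
    (C_inv : invariant_on omega (Omega omega) C)
    (C_alt : alternating_on (Omega omega) C)
    (C_cont : {within Omega omega, continuous C})
    (C_cocycle : forall x : 6.-tuple (projective R),
       Omega omega x -> coboundary C x = 0)
    (F : 5.-tuple (projective R) -> R) (F_Linfty : Linfty_inv omega mu F)
    (f : 4.-tuple (projective R) -> R) (f_L0 : L0_inv omega mu f)
    (C_eq : \forall x \ae tuple_measure mu 5,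
       Omega omega x -> C x = F x + coboundary f x)
    (Z : fsum R 5) (Z_cycle : orbit_cycle omega Z) :
  (`|pairing C Z|%:E <=
     20%:R%:E * (mass omega Z)%:E * 'N[tuple_measure mu 5]_+oo[EFin \o F])%E.
Proof.
have [_ F_norm] := F_Linfty; have [mf f_inv] := f_L0.
set N := ('N[_]_+oo[_])%E.
have N0 : (0 <= N)%E by exact: Lnorm_ge0.
have fN : N \is a fin_num by rewrite ge0_fin_numE.
have near_C : \forall x \ae tuple_measure mu 5,
    Omega omega x -> `|C x - coboundary f x| <= fine N.
  apply: filterS2 C_eq (ae_le_Lnorm_infty F_norm) => x CE FN xO.
  by rewrite CE// addrK.
pose nu := [the {sigma_finite_measure set ((4 + 4).-tuple (measurableTypeR R))
  ->
  \bar R} of tuple_measure (@lebesgue_measure R) (4 + 4)].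
have ae_row : forall r : 'rV[R[i]]_4, r != 0 -> \forall y \ae nu,
  r *m cvec y != 0.
  exact: (@ae_cvec_neq0 R 4).
have nu_gmap : forall g, g \in unitmx -> nonsingular nu nu (@gmap R g).
  exact: (@nonsingular_mulmx R 4).
have nu_pr : nonsingular nu mu (@pr R) by exact: nonsingular_proj.
have nu_gt0 : (0 < nu setT)%E.
  apply: tuple_measure_setT_gt0.
  have := @lebesgue_measure_itv R `]-oo, +oo[%R.
  by rewrite set_itvNyy /= => ->; exact: lt0y.
(* Lebesgue measure is forgotten here: besides sigma-finiteness, these four properties of [nu] carry
   the rest of the argument. *)
move: nu ae_row nu_gmap nu_pr nu_gt0 => nu ae_row nu_gmap nu_pr nu_gt0.
(* The frame of one generic quadruple [p] serves as the reference frame [d], with constant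
   [c = pscal p]. *)
have [p p0] := ae_ex nu_gt0 (ae_pscal omega_alt omega_nondeg ae_row).
have dd := darboux_frame (@omegaD R omega) (@omegaDr R omega) (@omegaZ R omega)
  omega_alt (vecs p 0) (vecs p 1) (vecs p 2) (vecs p 3).
have near_orbit := ae_near_coboundary omega_alt omega_nondeg ae_row nu_gmap
  nu_pr
  p0 dd nu_gt0 C_inv mf f_inv near_C.
have Finv g x : Sp omega g ->
    orbit_version omega nu (pframe omega p) f (actt g x) =
    orbit_version omega nu (pframe omega p) f x.
  exact: orbit_version_inv.
have close := primitive_close omega_alt omega_nondeg ae_row nu_gmap nu_gt0
  C_inv C_cocycle Finv near_orbit.
have pinv := primitive_inv omega_alt omega_nondeg ae_row nu_gmap C_inv Finv.
have := pairing_cycle_le C_inv C_alt pinv close _ Z_cycle.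
rewrite -(fineK fN) -!EFinM lee_fin mulrAC; apply.
apply: mulr_ge0; first exact: ler0n. exact: (fine_ge0 N0).
Qed.
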